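(* Suppose $w$ has polynomial growth, $\phi,\psi\in BUC_w(\mathbf Z,X)$, there is a closed subspace $Y$ of $L(X)$ containing all the resolvent operators of $A$ such that $C\circ\xi\in\mathcal F$ whenever $\xi\in\mathcal F$ and $C\in Y$, and $B\phi=A\circ\phi+\psi$. If $\psi|_J\in\mathcal F$, then $\theta_B(sp_{\mathcal F}(\phi))\subseteq\sigma(A)\cap p_B(\mathbf T)$.
   Context: $X$ is a complex Banach space and $L(X)$ the space of bounded linear operators on it; $J\in\{\mathbf Z,\mathbf Z_+\}$. $A$ is a closed, densely defined linear operator on $X$ with domain $D(A)$ and non-empty resolvent set; $\sigma(A)$ is its spectrum. $B:BUC_w(\mathbf Z,X)\to BUC_w(\mathbf Z,X)$ is given by $(B\phi)(n)=\sum_{j=0}^mb_j\phi(n+n_j)$ for some $b_j\in\mathbf C$, $n_j\in\mathbf Z$. $p_B(\zeta)=\sum_{j=0}^mb_j\zeta^{n_j}$; $\mathbf T$ is the unit circle. Characters of $\mathbf Z$ are $\gamma_\zeta(n)=\zeta^n$, $\zeta\in\mathbf T$, and $\theta_B(\gamma_\zeta)=p_B(\zeta)$. The equation $B\phi=A\circ\phi+\psi$ means $\phi(\mathbf Z)\subseteq D(A)$ and $(B\phi)(n)=A\phi(n)+\psi(n)$ for all $n\in\mathbf Z$. $\phi_h(t)=\phi(t+h)$, $\Delta_h\phi=\phi_h-\phi$. The weight $w:\mathbf Z\to\mathbf R$ satisfies $w\ge 1$, $w(s+t)\le w(s)w(t)$, $w(-t)=w(t)$, $\sum_{n\ge1}n^{-2}\log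 w(nt)<\infty$ for all $s,t\in\mathbf Z$; $w=1$ or $1/w\in C_0(\mathbf Z)$; and $\Delta_hw/w\in C_0(\mathbf Z)$ for every $h$. (A bounded weight is assumed to be $1$.) It has polynomial growth of order $N\in\mathbf Z_+$ if $\lim_{|m|\to\infty}w(mt)/(1+|m|^{N+1})=0$ for all $t\in\mathbf Z$ and $\inf_{m\in\mathbf Z}w(mt)/|m|^N>0$ for some $t$; it has polynomial growth if this holds for some $N$. $BUC_w(J,X)$ is the Banach space of all $\phi:J\to X$ with $\|\phi\|_{w,\infty}=\sup_{t\in J}\|\phi(t)\|/w(t)<\infty$. $\mathcal F$ is a translation invariant closed subspace of $BUC_w(J,X)$ such that: if $\phi\in BUC_w(\mathbf Z,X)$ and $\phi|_J\in\mathcal F$ then $\phi_t|_J\in\mathcal F$ for all $t\in\mathbf Z$. $L^1_w(\mathbf Z)$ is the space of $f:\mathbf Z\to\mathbf C$ with $\sum_n|f(n)|w(n)<\infty$; $\widehat f(\gamma)=\sum_n\gamma(-n)f(n)$; $\phi*f(n)=\sum_k\phi(n-k)f(k)$. $sp_{\mathcal F}(\phi)=\{\gamma\in\widehat{\mathbf Z}:\widehat f(\gamma)=0$ for all $f\in L^1_w(\mathbf Z)$ with $(\phi*f)|_J\in\mathcal F\}$. *)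

(* Defs.v *)
From Stdlib Require Import Reals ZArith Lia.
From Coquelicot Require Import Coquelicot.

Open Scope R_scope.

(** * Sums over [Z] *)

Definition is_sumZ {K : AbsRing} {V : NormedModule K} (g : Z -> V) (s : V) : Prop :=
  exists s1 s2 : V,
    is_series (fun k : nat => g (Z.of_nat k)) s1 /\
    is_series (fun k : nat => g (- Z.of_nat (S k))%Z) s2 /\
    s = plus s1 s2.

(** Unspecified when the sum does not exist. *)
Definition sumZ {K : AbsRing} {V : CompleteNormedModule K} (g : Z -> V) : V :=
  iota (is_sumZ g).

(** * Weights on [Z] *)

Definition C0 (g : Z -> R) : Prop :=
  forall eps : R, 0 < eps ->
    exists M : Z, forall n : Z, (M <= Z.abs n)%Z -> Rabs (g n) < eps.

Record is_weight (w : Z -> R) : Prop := {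
  weight_ge1 : forall t : Z, 1 <= w t;
  weight_submult : forall s t : Z, w (s + t)%Z <= w s * w t;
  weight_sym : forall t : Z, w (- t)%Z = w t;
  (* the index [k] stands for [n = k + 1] *)
  weight_nonquasianalytic : forall t : Z,
    ex_series (fun k : nat => ln (w (Z.of_nat (S k) * t)%Z) / INR (S k) ^ 2);
  weight_one_or_unbounded : (forall t : Z, w t = 1) \/ C0 (fun t => 1 / w t);
  weight_diff : forall h : Z, C0 (fun t => (w (t + h)%Z - w t) / w t)
}.

(** In the second clause [m = 0] is left out of the infimum: there the quotient
    is [+oo] (or [w 0 >= 1] if [N = 0]) in the usual convention, whereas
    [x / 0 = 0] here. *)
Definition polynomial_growth_of_order (w : Z -> R) (N : nat) : Prop :=
  (forall t : Z, C0 (fun m => w (m * t)%Z / (1 + Rabs (IZR m) ^ (N + 1)))) /\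
  (exists t : Z, exists c : R, 0 < c /\
     forall m : Z, m <> 0%Z -> c <= w (m * t)%Z / Rabs (IZR m) ^ N).

Definition polynomial_growth (w : Z -> R) : Prop :=
  exists N : nat, polynomial_growth_of_order w N.

(** * The index set [J], either [Z] or [Z_+ = {0, 1, 2, ...}] *)

Inductive index_set : Set := all_Z | nonneg_Z.

(** Boolean-valued, so that membership proofs are unique. *)
Definition mem (J : index_set) (t : Z) : bool :=
  match J with
  | all_Z => true
  | nonneg_Z => (0 <=? t)%Z
  end.

Definition elt (J : index_set) : Set := {t : Z | mem J t = true}.

Lemma mem_add (J : index_set) (s t : Z) :
  mem J s = true -> mem J t = true -> mem J (s + t)%Z = true.
Proof.
  destruct J; simpl; [easy |].
  rewrite !Z.leb_le. lia.
Qed.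

Definition add_elt {J : index_set} (s t : elt J) : elt J :=
  exist _ (proj1_sig s + proj1_sig t)%Z
    (mem_add J _ _ (proj2_sig s) (proj2_sig t)).

Definition restrict {X : Type} (J : index_set) (phi : Z -> X) : elt J -> X :=
  fun t => phi (proj1_sig t).

Definition translate {X : Type} (h : Z) (phi : Z -> X) : Z -> X :=
  fun t => phi (t + h)%Z.

Definition translateJ {X : Type} {J : index_set} (h : elt J) (xi : elt J -> X) :
    elt J -> X :=
  fun t => xi (add_elt t h).

(** * Weighted spaces of vector-valued functions *)

Section WeightedSpaces.

Context {K : AbsRing} {X : NormedModule K} {T : Type}.

(** Every function on [Z] or [Z_+] is uniformly continuous, so [BUC_w] is only
    a boundedness condition. *)
Definition BUC (w : T -> R) (phi : T -> X) : Prop :=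
  exists M : R, forall t : T, norm (phi t) / w t <= M.

Definition wnorm (w : T -> R) (phi : T -> X) : R :=
  real (Lub_Rbar (fun r => exists t : T, r = norm (phi t) / w t)).

Definition closed_subspace_BUC (w : T -> R) (F : (T -> X) -> Prop) : Prop :=
  (forall xi, F xi -> BUC w xi) /\
  F (fun _ => zero) /\
  (forall xi eta, F xi -> F eta -> F (fun t => plus (xi t) (eta t))) /\
  (forall (c : K) xi, F xi -> F (fun t => scal c (xi t))) /\
  (forall phi, BUC w phi ->
     (forall eps : R, 0 < eps ->
        exists xi, F xi /\ wnorm w (fun t => minus (phi t) (xi t)) < eps) ->
     F phi).

End WeightedSpaces.

Definition admissible_class {K : AbsRing} {X : NormedModule K} (w : Z -> R)
    (J : index_set) (F : (elt J -> X) -> Prop) : Prop :=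
  closed_subspace_BUC (restrict J w) F /\
  (forall (h : elt J) (xi : elt J -> X), F xi -> F (translateJ h xi)) /\
  (forall phi : Z -> X, BUC w phi -> F (restrict J phi) ->
     forall t : Z, F (restrict J (translate t phi))).

(** * Bounded and unbounded operators *)

Section Operators.

Context {X : CompleteNormedModule C_AbsRing}.

(** [L(X)] is the set of [T : X -> X] with [is_linear T], which includes
    boundedness. *)
Definition opnorm (T : X -> X) : R :=
  real (Lub_Rbar (fun r => exists x : X, norm x <= 1 /\ r = norm (T x))).

Definition closed_subspace_L (Y : (X -> X) -> Prop) : Prop :=
  (forall T, Y T -> is_linear T) /\
  Y (fun _ => zero) /\
  (forall S T, Y S -> Y T -> Y (fun x => plus (S x) (T x))) /\
  (forall (c : C) T, Y T -> Y (fun x => scal c (T x))) /\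
  (forall T : X -> X, is_linear T ->
     (forall eps : R, 0 < eps ->
        exists S, Y S /\ opnorm (fun x => minus (T x) (S x)) < eps) ->
     Y T).

(** An unbounded operator is a pair of a domain [D] and a function [A] on [X];
    the values of [A] outside [D] are junk and are never used. *)
Record closed_densely_defined (D : X -> Prop) (A : X -> X) : Prop := {
  dom_zero : D zero;
  dom_plus : forall x y, D x -> D y -> D (plus x y);
  dom_scal : forall (c : C) x, D x -> D (scal c x);
  op_plus : forall x y, D x -> D y -> A (plus x y) = plus (A x) (A y);
  op_scal : forall (c : C) x, D x -> A (scal c x) = scal c (A x);
  op_closed : closed (fun p : X * X => D (fst p) /\ snd p = A (fst p));
  op_dense : forall (x : X) (eps : R), 0 < eps ->
    exists u, D u /\ norm (minus u x) < eps
}.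

(** [S] is the bounded inverse of [lambda - A : D -> X]. *)
Definition is_resolvent_op (D : X -> Prop) (A : X -> X) (lambda : C) (S : X -> X) : Prop :=
  is_linear S /\
  (forall x, D (S x) /\ minus (scal lambda (S x)) (A (S x)) = x) /\
  (forall x, D x -> S (minus (scal lambda x) (A x)) = x).

Definition resolvent_set (D : X -> Prop) (A : X -> X) (lambda : C) : Prop :=
  exists S, is_resolvent_op D A lambda S.

Definition spectrum (D : X -> Prop) (A : X -> X) (lambda : C) : Prop :=
  ~ resolvent_set D A lambda.

End Operators.

(** * Characters of [Z] *)

Definition Cpowz (z : C) (n : Z) : C :=
  match n with
  | Z0 => RtoC 1
  | Zpos p => Cpow z (Pos.to_nat p)
  | Zneg p => Cinv (Cpow z (Pos.to_nat p))
  end.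

Definition unit_circle (zeta : C) : Prop := Cmod zeta = 1.

Definition char_Z (zeta : C) : Z -> C := fun n => Cpowz zeta n.

Definition is_character (gamma : Z -> C) : Prop :=
  exists zeta : C, unit_circle zeta /\ forall n : Z, gamma n = char_Z zeta n.

(** * The difference operator [B] and its symbol *)

Definition opB {X : NormedModule C_AbsRing} (m : nat) (b : nat -> C) (nu : nat -> Z)
    (phi : Z -> X) : Z -> X :=
  fun n => sum_n (fun j => scal (b j) (phi (n + nu j)%Z)) m.

Definition pB (m : nat) (b : nat -> C) (nu : nat -> Z) (zeta : C) : C :=
  sum_n (fun j => Cmult (b j) (Cpowz zeta (nu j))) m.

(** The character [gamma] determines its parameter [zeta = gamma 1]. *)
Definition thetaB (m : nat) (b : nat -> C) (nu : nat -> Z) (gamma : Z -> C) : C :=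
  pB m b nu (gamma 1%Z).

Lemma thetaB_char (m : nat) (b : nat -> C) (nu : nat -> Z) (zeta : C) :
  thetaB m b nu (char_Z zeta) = pB m b nu zeta.
Proof.
  unfold thetaB, char_Z; simpl.
  now rewrite Cmult_1_r.
Qed.

(** * The spectrum relative to a class *)

Definition L1 (w : Z -> R) (f : Z -> C) : Prop :=
  exists s : R, is_sumZ (fun n => Cmod (f n) * w n) s.

Definition fourier (f : Z -> C) (gamma : Z -> C) : C :=
  sumZ (V := C_CompleteNormedModule) (fun n => Cmult (gamma (- n)%Z) (f n)).

Definition conv {X : CompleteNormedModule C_AbsRing} (phi : Z -> X) (f : Z -> C) : Z -> X :=
  fun n => sumZ (fun k => scal (f k) (phi (n - k)%Z)).

Definition sp {X : CompleteNormedModule C_AbsRing} (w : Z -> R) (J : index_set)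
    (F : (elt J -> X) -> Prop) (phi : Z -> X) (gamma : Z -> C) : Prop :=
  is_character gamma /\
  forall f : Z -> C, L1 w f -> F (restrict J (conv phi f)) ->
    fourier f gamma = RtoC 0.

(* Main.v *)
(* Write B - z for the difference operator shifted by z = p_B(zeta), and suppose
   that S = (z - A)^{-1} exists. Applying S to the equation gives
   phi = -S (B - z) phi + S psi, so that modulo F, phi agrees with
   (-S (B - z))^n phi for every n. For f in L^1_w the convolution of this iterate
   with f is (-S)^n (phi * (B - z)^n f). The symbol of B - z vanishes at zeta; for
   f(k) = zeta^k (sin(d k) / k)^P, whose spectrum lies in a small neighbourhood of
   zeta, the weighted norms of (B - z)^n f therefore decrease like r^n with r as
   small as desired when d is small. Choosing r ||S|| < 1 and using that F is
   closed, phi * f restricted to J lies in F, while the Fourier transform of f at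
   zeta is positive: zeta is not in the spectrum of phi. *)

Require Import Defs.
From Stdlib Require Import Reals ZArith Lia Lra Psatz FunctionalExtensionality.
From Coquelicot Require Import Coquelicot.

(** * Sums over [Z] *)

(** Everything rests on a bound for the n-th iterate with one constant in front and a geometric
    rate. No Fourier inversion enters: the rate is read off iterated forward differences. After
    modulation by [zeta] the coefficients of B - z sum to zero, so B - z is a combination of terms
    (translation minus identity), each dominated in weighted norm by one forward difference. The
    constant [D] so obtained depends on the weight and the coefficients but not on the test
    function, so the band can be narrowed once [D] and a norm bound for S are known. Differences of
    every order are small because sin(d k) / k is an integral of cosines of frequency at most d. The
    exponent P must beat the growth of the weight, leave three more powers of [rho], and be even.
    Two of these powers make sums over Z converge; the third gives truncated convolutions a rate of
    convergence, which keeps convolutions inside the class. Evenness makes the unmodulated function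
    nonnegative, so its sum, the transform at [zeta], is positive without being computed. *)

Lemma plus_minus_l {K : AbsRing} {V : NormedModule K} (x y : V) :
  @plus (NormedModule.AbelianMonoid K V) (minus x y) y = x.
Proof.
  unfold minus. rewrite <- plus_assoc.
  transitivity (plus x zero); [f_equal; apply (plus_opp_l y)|apply plus_zero_r].
Qed.

Lemma plus_plus_opp {K : AbsRing} {V : NormedModule K} (x y : V) :
  @plus (NormedModule.AbelianMonoid K V) (plus x y) (opp y) = x.
Proof.
  rewrite <- plus_assoc.
  transitivity (plus x zero); [f_equal; apply (plus_opp_r y)|apply plus_zero_r].
Qed.

Section SumsOverZ.

Context {K : AbsRing} {V : NormedModule K}.

Lemma is_series_inj (a : nat -> V) (s s' : V) :
  is_series a s -> is_series a s' -> s = s'.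
Proof. apply filterlim_locally_unique. Qed.

Lemma is_sumZ_unique (g : Z -> V) (s s' : V) :
  is_sumZ g s -> is_sumZ g s' -> s = s'.
Proof.
  intros (s1 & s2 & H1 & H2 & ->) (s1' & s2' & H1' & H2' & ->).
  now rewrite (is_series_inj _ _ _ H1 H1'), (is_series_inj _ _ _ H2 H2').
Qed.

Lemma is_sumZ_ext (g g' : Z -> V) (s : V) :
  (forall k, g k = g' k) -> is_sumZ g s -> is_sumZ g' s.
Proof.
  intros E (s1 & s2 & H1 & H2 & ->).
  exists s1, s2; repeat split.
  - now apply (is_series_ext (fun k : nat => g (Z.of_nat k))).
  - now apply (is_series_ext (fun k : nat => g (- Z.of_nat (S k))%Z)).
Qed.

Lemma plus_plus_swap (a b c d : V) :
  plus (plus a b) (plus c d) = plus (plus a c) (plus b d).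
Proof.
  rewrite <- !plus_assoc; f_equal.
  rewrite !plus_assoc; f_equal. apply plus_comm.
Qed.

Lemma is_sumZ_plus (g g' : Z -> V) (s s' : V) :
  is_sumZ g s -> is_sumZ g' s' -> is_sumZ (fun k => plus (g k) (g' k)) (plus s s').
Proof.
  intros (s1 & s2 & H1 & H2 & ->) (s1' & s2' & H1' & H2' & ->).
  exists (plus s1 s1'), (plus s2 s2'); repeat split.
  - now apply is_series_plus.
  - now apply is_series_plus.
  - apply plus_plus_swap.
Qed.

Lemma is_sumZ_scal (c : K) (g : Z -> V) (s : V) :
  is_sumZ g s -> is_sumZ (fun k => scal c (g k)) (scal c s).
Proof.
  intros (s1 & s2 & H1 & H2 & ->).
  exists (scal c s1), (scal c s2); repeat split.
  - now apply is_series_scal.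
  - now apply is_series_scal.
  - exact (scal_distr_l c s1 s2).
Qed.

(** The cut between the two half-series moves by one: [g 0] leaves the first half and enters the
    second. *)
Lemma is_sumZ_succ (g : Z -> V) (s : V) :
  is_sumZ g s -> is_sumZ (fun k => g (k + 1)%Z) s.
Proof.
  intros (s1 & s2 & H1 & H2 & ->).
  exists (minus s1 (g 0%Z)), (plus s2 (g 0%Z)); repeat split.
  - apply (is_series_ext (fun k : nat => g (Z.of_nat (S k)))).
    + intros n; f_equal; lia.
    + apply (is_series_incr_1 (fun k : nat => g (Z.of_nat k))).
      change (Z.of_nat 0) with 0%Z. rewrite plus_minus_l. exact H1.
  - apply is_series_decr_1.
    apply (is_series_ext (fun k : nat => g (- Z.of_nat (S k))%Z)).
    + intros n; f_equal; lia.
    + replace (- Z.of_nat 1 + 1)%Z with 0%Z by lia.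
      now rewrite plus_plus_opp.
  - now rewrite (plus_comm s2), plus_assoc, plus_minus_l.
Qed.

Lemma is_sumZ_pred (g : Z -> V) (s : V) :
  is_sumZ g s -> is_sumZ (fun k => g (k - 1)%Z) s.
Proof.
  intros (s1 & s2 & H1 & H2 & ->).
  exists (plus s1 (g (-1)%Z)), (minus s2 (g (-1)%Z)); repeat split.
  - apply is_series_decr_1.
    apply (is_series_ext (fun k : nat => g (Z.of_nat k))).
    + intros n; f_equal; lia.
    + replace (Z.of_nat 0 - 1)%Z with (-1)%Z by lia.
      now rewrite plus_plus_opp.
  - apply (is_series_ext (fun k : nat => g (- Z.of_nat (S (S k)))%Z)).
    + intros n; f_equal; lia.
    + apply (is_series_incr_1 (fun k : nat => g (- Z.of_nat (S k))%Z)).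
      replace (- Z.of_nat 1)%Z with (-1)%Z by lia.
      rewrite plus_minus_l. exact H2.
  - rewrite <- plus_assoc, (plus_comm (g (-1)%Z)). now rewrite plus_minus_l.
Qed.

(** A sum over Z is two half-series cut at 0, so translation is not a plain reindexing; it is
    reached through unit shifts in both directions. *)
Lemma is_sumZ_translate (h : Z) (g : Z -> V) (s : V) :
  is_sumZ g s -> is_sumZ (fun k => g (k + h)%Z) s.
Proof.
  revert g. pattern h. apply Z.bi_induction; clear h.
  - intros x y ->; tauto.
  - intros g. apply is_sumZ_ext. intros k; f_equal; lia.
  - intros h; split; intros IH g H.
    + apply (is_sumZ_ext (fun k => g (k + h + 1)%Z)).
      * intros k; f_equal; lia.
      * exact (IH _ (is_sumZ_succ _ _ H)).
    + apply (is_sumZ_ext (fun k => g (k + Z.succ h - 1)%Z)).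
      * intros k; f_equal; lia.
      * exact (IH _ (is_sumZ_pred _ _ H)).
Qed.

Lemma sum_n_zero (n : nat) : sum_n (fun _ : nat => zero : V) n = zero.
Proof.
  induction n as [|n IH].
  - apply sum_O.
  - now rewrite sum_Sn, IH, plus_zero_l.
Qed.

Lemma is_series_zero : is_series (fun _ : nat => zero : V) zero.
Proof.
  apply (filterlim_ext (fun _ => zero)).
  - intros n; now rewrite sum_n_zero.
  - apply filterlim_const.
Qed.

Lemma is_sumZ_single (g : Z -> V) (k0 : Z) :
  (forall k, k <> k0 -> g k = zero) -> is_sumZ g (g k0).
Proof.
  intros H0.
  (* Recentred at [k0], the only nonzero term is the first one of the nonnegative half. *)
  apply (is_sumZ_ext (fun k => (fun j => g (j + k0)%Z) (k + - k0)%Z)).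
  { intros k; simpl; f_equal; lia. }
  apply (is_sumZ_translate (- k0) (fun j => g (j + k0)%Z)).
  exists (g k0), zero; repeat split.
  - apply is_series_decr_1.
    replace (Z.of_nat 0 + k0)%Z with k0 by lia.
    replace (plus (g k0) (opp (g k0))) with (zero : V) by (symmetry; apply (plus_opp_r (g k0))).
    apply (is_series_ext (fun _ => zero)), is_series_zero.
    intros n; symmetry; apply H0; lia.
  - apply (is_series_ext (fun _ => zero)), is_series_zero.
    intros n; symmetry; apply H0; lia.
  - now rewrite plus_zero_r.
Qed.

End SumsOverZ.

Lemma sumZ_unique {K : AbsRing} {V : CompleteNormedModule K} (g : Z -> V) (s : V) :
  is_sumZ g s -> sumZ g = s.
Proof.
  intros H. apply iota_unique; [|exact H].
  intros y Hy. exact (is_sumZ_unique _ _ _ Hy H).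
Qed.

(** Additivity and a norm bound replace linearity so that source and target may have different
    scalars; this covers [RtoC], from the reals to the complex numbers. *)
Lemma filterlim_additive {K K' : AbsRing} {V : NormedModule K} {V' : NormedModule K'}
  (h : V -> V') (M : R) (u : nat -> V) (l : V) :
  (forall x y, h (plus x y) = plus (h x) (h y)) ->
  (forall x, norm (h x) <= M * norm x) ->
  filterlim u eventually (locally l) ->
  filterlim (fun n => h (u n)) eventually (locally (h l)).
Proof.
  intros Hp HM Hu.
  apply filterlim_locally_ball_norm. intros eps.
  (* [M] may be zero or negative, and a positive divisor is needed. *)
  assert (HM' : 0 < Rabs M + 1) by (pose proof (Rabs_pos M); lra).
  assert (He : 0 < eps / (Rabs M + 1)) by (apply Rdiv_lt_0_compat; [apply cond_pos|exact HM']).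
  pose proof (proj1 (filterlim_locally_ball_norm _ _) Hu (mkposreal _ He)) as Hev.
  revert Hev. apply filter_imp. intros n. unfold ball_norm; simpl. intros Hn.
  assert (Hm : minus (h (u n)) (h l) = h (minus (u n) l)).
  { rewrite <- (plus_minus_l (u n) l) at 1. rewrite Hp. apply plus_plus_opp. }
  rewrite Hm.
  apply Rle_lt_trans with (1 := HM _).
  apply Rle_lt_trans with ((Rabs M + 1) * norm (minus (u n) l)).
  - apply Rmult_le_compat_r; [apply norm_ge_0|]. pose proof (Rle_abs M); lra.
  - apply Rlt_le_trans with ((Rabs M + 1) * (eps / (Rabs M + 1))).
    + now apply Rmult_lt_compat_l.
    + right. field. lra.
Qed.

Lemma is_series_additive {K K' : AbsRing} {V : NormedModule K} {V' : NormedModule K'}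
  (h : V -> V') (M : R) (a : nat -> V) (l : V) :
  (forall x y, h (plus x y) = plus (h x) (h y)) ->
  (forall x, norm (h x) <= M * norm x) ->
  is_series a l -> is_series (fun n => h (a n)) (h l).
Proof.
  intros Hp HM Ha.
  apply (filterlim_ext (fun n => h (sum_n a n))).
  - intros n; induction n as [|n IH].
    + now rewrite !sum_O.
    + now rewrite !sum_Sn, Hp, IH.
  - now apply (filterlim_additive h M).
Qed.

Lemma is_sumZ_additive {K K' : AbsRing} {V : NormedModule K} {V' : NormedModule K'}
  (h : V -> V') (M : R) (g : Z -> V) (s : V) :
  (forall x y, h (plus x y) = plus (h x) (h y)) ->
  (forall x, norm (h x) <= M * norm x) ->
  is_sumZ g s -> is_sumZ (fun k => h (g k)) (h s).
Proof.
  intros Hp HM (s1 & s2 & H1 & H2 & ->).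
  exists (h s1), (h s2); repeat split.
  - now apply (is_series_additive h M (fun k : nat => g (Z.of_nat k))).
  - now apply (is_series_additive h M (fun k : nat => g (- Z.of_nat (S k))%Z)).
  - apply Hp.
Qed.

Lemma is_sumZ_linear {K : AbsRing} {V V' : NormedModule K}
  (h : V -> V') (g : Z -> V) (s : V) :
  is_linear h -> is_sumZ g s -> is_sumZ (fun k => h (g k)) (h s).
Proof.
  intros [Hp _ [M [_ HM]]]. now apply (is_sumZ_additive h M).
Qed.

Lemma is_series_telescope (c : R) :
  is_series (fun n : nat => c * (/ INR (S n) - / INR (S (S n)))) c.
Proof.
  apply (filterlim_ext (fun n : nat => c * (1 - / INR (S (S n))))).
  - intros n; induction n as [|n IH].
    + rewrite sum_O. simpl. lra.
    + rewrite sum_Sn, <- IH.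
      change (c * (1 - / INR (S (S (S n)))) =
        c * (1 - / INR (S (S n))) + c * (/ INR (S (S n)) - / INR (S (S (S n))))). ring.
  - change (is_lim_seq (fun n : nat => c * (1 - / INR (S (S n)))) c).
    replace (Finite c) with (Rbar_mult c (Rbar_minus 1 0)) by (simpl; f_equal; ring).
    apply is_lim_seq_scal_l.
    apply is_lim_seq_minus'; [apply is_lim_seq_const|].
    apply (is_lim_seq_incr_1 (fun n => / INR (S n)) 0).
    apply (is_lim_seq_incr_1 (fun n => / INR n) 0).
    replace (Finite 0) with (Rbar_inv p_infty) by reflexivity.
    apply is_lim_seq_inv; [apply is_lim_seq_INR|discriminate].
Qed.

(** With x = n + 1 the right side is 2 / (x (x + 1)), and x + 1 <= 2 x. This gives the inverse
    squares a majorant with an explicit sum. *)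
Lemma inv_square_le_telescope (n : nat) :
  / INR (S n) ^ 2 <= 2 * (/ INR (S n) - / INR (S (S n))).
Proof.
  rewrite (S_INR (S n)). generalize (S_INR n). set (x := INR (S n)). intros Hn.
  assert (Hx : 1 <= x) by (pose proof (pos_INR n); lra).
  replace (2 * (/ x - / (x + 1))) with (/ x ^ 2 + (x - 1) / (x ^ 2 * (x + 1))) by (field; lra).
  assert (0 <= (x - 1) / (x ^ 2 * (x + 1))); [|lra].
  apply Rmult_le_pos; [lra|]. apply Rlt_le, Rinv_0_lt_compat. nra.
Qed.

Lemma is_series_norm_le {K : AbsRing} {V : NormedModule K} (a : nat -> V) (s : V)
  (b : nat -> R) (t : R) :
  (forall n, norm (a n) <= b n) -> is_series a s -> is_series b t -> norm s <= t.
Proof.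
  intros Hab Ha Hb.
  assert (H1 : is_lim_seq (fun n => norm (sum_n a n)) (norm s)).
  { apply (filterlim_comp _ _ _ (sum_n a) norm eventually (locally s)).
    - exact Ha.
    - apply filterlim_norm. }
  apply (is_lim_seq_le (fun n => norm (sum_n a n)) (sum_n b) (norm s) t).
  - intros n. eapply Rle_trans; [apply norm_sum_n_m|]. now apply sum_n_m_le.
  - exact H1.
  - exact Hb.
Qed.

(** Shifting the absolute value by 1 makes [rho] at least 1 and submultiplicative, so [w] times a
    power of [rho] keeps these two properties. *)
Definition rho (k : Z) : R := 1 + Rabs (IZR k).

Lemma rho_ge1 (k : Z) : 1 <= rho k.
Proof. unfold rho. pose proof (Rabs_pos (IZR k)); lra. Qed.

Lemma rho_sym (k : Z) : rho (- k) = rho k.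
Proof. unfold rho. now rewrite opp_IZR, Rabs_Ropp. Qed.

Lemma rho_submult (s t : Z) : rho (s + t) <= rho s * rho t.
Proof.
  unfold rho. rewrite plus_IZR.
  pose proof (Rabs_triang (IZR s) (IZR t)).
  pose proof (Rabs_pos (IZR s)). pose proof (Rabs_pos (IZR t)). nra.
Qed.

(** Both halves have the same telescoping majorant, of sum [2 * c]; hence the factor 4. *)
Lemma is_sumZ_dominated {K : AbsRing} {V : CompleteNormedModule K} (a : Z -> V) (c : R) :
  (forall k, norm (a k) <= c / rho k ^ 2) ->
  exists s : V, is_sumZ a s /\ norm s <= 4 * c.
Proof.
  intros Ha.
  assert (Hc : 0 <= c).
  { specialize (Ha 0%Z). pose proof (norm_ge_0 (a 0%Z)). unfold rho in Ha.
    rewrite Rabs_R0 in Ha. replace (c / (1 + 0) ^ 2) with c in Ha by field. lra. }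
  set (b := fun n : nat => (2 * c) * (/ INR (S n) - / INR (S (S n)))).
  assert (Hb : is_series b (2 * c)) by apply is_series_telescope.
  assert (Hstep : forall n : nat, c / INR (S n) ^ 2 <= b n).
  { intros n. unfold b. pose proof (inv_square_le_telescope n).
    unfold Rdiv. rewrite (Rmult_comm 2 c), Rmult_assoc.
    now apply Rmult_le_compat_l. }
  assert (H1 : forall n : nat, norm (a (Z.of_nat n)) <= b n).
  { intros n. eapply Rle_trans; [apply Ha|]. eapply Rle_trans; [|apply Hstep].
    right; f_equal; f_equal. unfold rho.
    rewrite <- INR_IZR_INZ, Rabs_pos_eq by apply pos_INR. rewrite S_INR; ring. }
  assert (H2 : forall n : nat, norm (a (- Z.of_nat (S n))%Z) <= b n).
  { intros n. eapply Rle_trans; [apply Ha|]. eapply Rle_trans; [|apply Hstep].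
    rewrite rho_sym. unfold rho. rewrite <- INR_IZR_INZ, Rabs_pos_eq by apply pos_INR.
    assert (0 < INR (S n)) by (apply lt_0_INR; lia).
    unfold Rdiv. apply Rmult_le_compat_l; [exact Hc|].
    apply Rinv_le_contravar; [apply pow_lt; lra|]. apply pow_incr; lra. }
  destruct (ex_series_le _ _ H1 (ex_intro _ _ Hb)) as [s1 Hs1].
  destruct (ex_series_le _ _ H2 (ex_intro _ _ Hb)) as [s2 Hs2].
  exists (plus s1 s2); split.
  - exists s1, s2; auto.
  - eapply Rle_trans; [apply norm_triangle|].
    pose proof (is_series_norm_le _ _ _ _ H1 Hs1 Hb).
    pose proof (is_series_norm_le _ _ _ _ H2 Hs2 Hb). lra.
Qed.

Lemma is_series_ge_first (a : nat -> R) (s : R) :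
  (forall n, 0 <= a n) -> is_series a s -> a 0%nat <= s.
Proof.
  intros Ha Hs.
  apply (is_lim_seq_le (fun _ => a 0%nat) (sum_n a) (a 0%nat) s).
  - intros n; induction n as [|n IH].
    + rewrite sum_O; apply Rle_refl.
    + rewrite sum_Sn. specialize (Ha (S n)). change (a 0%nat <= sum_n a n + a (S n)). lra.
  - apply is_lim_seq_const.
  - exact Hs.
Qed.

Lemma is_sumZ_pos (g : Z -> R) (s : R) :
  (forall k, 0 <= g k) -> 0 < g 0%Z -> is_sumZ g s -> 0 < s.
Proof.
  intros Hg H0 (s1 & s2 & H1 & H2 & ->). change (0 < s1 + s2).
  apply is_series_ge_first in H1; [|intros; apply Hg].
  apply is_series_ge_first in H2; [|intros; apply Hg].
  simpl (Z.of_nat 0) in H1. pose proof (Hg (- Z.of_nat 1)%Z). lra.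
Qed.

(** * Band-limited sequences *)

Section Differences.

Context {G : AbelianGroup}.

Definition delta (u : Z -> G) : Z -> G := fun k => minus (u (k + 1)%Z) (u k).

(** The recursion applies [delta] innermost, so an identity for [delta u] can be rewritten under
    [diff n] in each induction. *)
Fixpoint diff (n : nat) (u : Z -> G) : Z -> G :=
  match n with
  | 0%nat => u
  | S n => diff n (delta u)
  end.

Lemma diff_translate (n : nat) (u : Z -> G) (h k : Z) :
  diff n (translate h u) k = diff n u (k + h)%Z.
Proof.
  revert u; induction n as [|n IH]; intros u; [reflexivity|]; simpl.
  rewrite <- IH. f_equal. extensionality j. unfold delta, translate.
  now replace (j + 1 + h)%Z with (j + h + 1)%Z by lia.
Qed.

End Differences.

Lemma diff_plus (n : nat) (u v : Z -> R) (k : Z) :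
  diff n (fun k => u k + v k) k = diff n u k + diff n v k.
Proof.
  revert u v; induction n as [|n IH]; intros u v; [reflexivity|]; simpl.
  rewrite <- IH. f_equal. extensionality j.
  unfold delta. change (u (j + 1)%Z + v (j + 1)%Z - (u j + v j) =
    u (j + 1)%Z - u j + (v (j + 1)%Z - v j)). ring.
Qed.

Lemma diff_scal (n : nat) (c : R) (u : Z -> R) (k : Z) :
  diff n (fun k => c * u k) k = c * diff n u k.
Proof.
  revert u; induction n as [|n IH]; intros u; [reflexivity|]; simpl.
  rewrite <- IH. f_equal. extensionality j.
  unfold delta. change (c * u (j + 1)%Z - c * u j = c * (u (j + 1)%Z - u j)). ring.
Qed.

Lemma diff_RtoC (n : nat) (u : Z -> R) (k : Z) :
  diff n (fun k => RtoC (u k)) k = RtoC (diff n u k).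
Proof.
  revert u; induction n as [|n IH]; intros u; [reflexivity|]; simpl.
  rewrite <- IH. f_equal. extensionality j.
  unfold delta. change (Cminus (u (j + 1)%Z) (u j) = RtoC (u (j + 1)%Z - u j)).
  now rewrite RtoC_minus.
Qed.

(** The commutator of multiplication by the index with the n-th difference. It turns decay in [k]
    into a bound on differences of [k * u k], which for the sinc sequence is a plain sine. At n = 0
    the value of [pred] is harmless, its coefficient being 0. *)
Lemma mul_index_diff (n : nat) (u : Z -> R) (k : Z) :
  IZR k * diff n u k =
  diff n (fun j => IZR j * u j) k - INR n * diff (pred n) u (k + 1)%Z.
Proof.
  revert u k; induction n as [|n IH]; intros u k; [simpl; ring|].
  simpl diff. rewrite IH.
  assert (E : delta (fun j => IZR j * u j) =
    (fun j => IZR j * delta u j + translate 1 u j)).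
  { extensionality j. unfold delta, translate.
    change (IZR (j + 1) * u (j + 1)%Z - IZR j * u j =
      IZR j * (u (j + 1)%Z - u j) + u (j + 1)%Z).
    rewrite plus_IZR. ring. }
  rewrite E, diff_plus, diff_translate, S_INR. simpl pred.
  destruct n as [|n]; simpl pred; simpl diff; simpl (INR 0); ring.
Qed.

(** A discrete Bernstein inequality with weight [p]: one constant serves all orders, and the rate
    [a] stands for the width of the band. *)
Definition controlled (p : Z -> R) (c a : R) (u : Z -> R) : Prop :=
  forall (n : nat) (k : Z), p k * Rabs (diff n u k) <= c * a ^ n.

Lemma controlled_delta (p : Z -> R) (c a : R) (u : Z -> R) :
  controlled p c a u -> controlled p (c * a) a (delta u).
Proof.
  intros H n k. specialize (H (S n) k). simpl in H. lra.
Qed.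

(* The product rule in the form [delta (u v) = delta u * v + u * delta v +
   delta u * delta v] involves no translates, so the growth rates combine
   as [1 + r = (1 + a) (1 + b)]. *)
Lemma controlled_mult (p q : Z -> R) (c d a b : R) (u v : Z -> R) :
  (forall k, 0 <= p k) -> (forall k, 0 <= q k) ->
  controlled p c a u -> controlled q d b v ->
  controlled (fun k => p k * q k) (c * d) (a + b + a * b) (fun k => u k * v k).
Proof.
  intros Hp Hq Hu Hv n.
  revert c d u v Hu Hv; induction n as [|n IH]; intros c d u v Hu Hv k.
  - specialize (Hu 0%nat k). specialize (Hv 0%nat k). simpl in *.
    rewrite Rabs_mult.
    replace (p k * q k * (Rabs (u k) * Rabs (v k)))
      with ((p k * Rabs (u k)) * (q k * Rabs (v k))) by ring.
    replace (c * d * 1) with ((c * 1) * (d * 1)) by ring.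
    specialize (Hp k). specialize (Hq k).
    apply Rmult_le_compat; auto using Rmult_le_pos, Rabs_pos.
  - assert (E : delta (fun k => u k * v k) =
      (fun k => (delta u k * v k + u k * delta v k) + delta u k * delta v k)).
    { extensionality j. unfold delta.
      change (u (j + 1)%Z * v (j + 1)%Z - u j * v j =
        (u (j + 1)%Z - u j) * v j + u j * (v (j + 1)%Z - v j)
        + (u (j + 1)%Z - u j) * (v (j + 1)%Z - v j)). ring. }
    simpl diff. rewrite E, !diff_plus.
    pose proof (IH _ _ _ _ (controlled_delta _ _ _ _ Hu) Hv k) as H1.
    pose proof (IH _ _ _ _ Hu (controlled_delta _ _ _ _ Hv) k) as H2.
    pose proof (IH _ _ _ _ (controlled_delta _ _ _ _ Hu) (controlled_delta _ _ _ _ Hv) k) as H3.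
    cbv beta in H1, H2, H3.
    set (x := diff n (fun k => delta u k * v k) k) in *.
    set (y := diff n (fun k => u k * delta v k) k) in *.
    set (z := diff n (fun k => delta u k * delta v k) k) in *.
    assert (Hpq : 0 <= p k * q k) by auto using Rmult_le_pos.
    assert (Ht : Rabs (x + y + z) <= Rabs x + Rabs y + Rabs z).
    { pose proof (Rabs_triang (x + y) z). pose proof (Rabs_triang x y). lra. }
    apply (Rmult_le_compat_l _ _ _ Hpq) in Ht. simpl pow.
    eapply Rle_trans; [exact Ht|]. lra.
Qed.

Lemma controlled_pow (p : Z -> R) (c a : R) (u : Z -> R) (P : nat) :
  (forall k, 0 <= p k) -> controlled p c a u ->
  controlled (fun k => p k ^ P) (c ^ P) ((1 + a) ^ P - 1) (fun k => u k ^ P).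
Proof.
  intros Hp Hu; induction P as [|P IH].
  (* The zeroth power is the constant 1, with rate 0: its differences of positive order vanish. *)
  - intros n k. simpl.
    assert (E : delta (fun _ : Z => 1) = (fun _ => 0 * 1)).
    { extensionality j. unfold delta. change (1 - 1 = 0 * 1). ring. }
    destruct n as [|n].
    + simpl. rewrite Rabs_R1. lra.
    + simpl diff. rewrite E, (diff_scal n 0 (fun _ => 1)), Rmult_0_l, Rabs_R0. simpl pow. lra.
  - simpl. replace ((1 + a) * (1 + a) ^ P - 1)
      with (a + ((1 + a) ^ P - 1) + a * ((1 + a) ^ P - 1)) by ring.
    apply (controlled_mult p (fun k => p k ^ P)); auto using pow_le.
Qed.

(** * Differences of cosines and of the sinc sequence *)

Lemma delta_cos (t a : R) :
  delta (fun k => cos (t * IZR k + a)) =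
  (fun k => 2 * sin (t / 2) * cos (t * IZR k + (a + (t / 2 + PI / 2)))).
Proof.
  extensionality k. unfold delta.
  change (cos (t * IZR (k + 1) + a) - cos (t * IZR k + a) =
    2 * sin (t / 2) * cos (t * IZR k + (a + (t / 2 + PI / 2)))).
  rewrite form2, plus_IZR.
  replace ((t * (IZR k + 1) + a - (t * IZR k + a)) / 2) with (t / 2) by field.
  replace ((t * (IZR k + 1) + a + (t * IZR k + a)) / 2) with (t * IZR k + a + t / 2) by field.
  replace (t * IZR k + (a + (t / 2 + PI / 2))) with (PI / 2 + (t * IZR k + a + t / 2)) by ring.
  rewrite <- Ropp_involutive with (r := cos _), <- sin_cos. ring.
Qed.

(** Each difference of a cosine of frequency [t] is a cosine of the same frequency times 2 sin(t /
    2) <= t. Only the phase changes, so the induction runs over all phases [a]. *)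
Lemma diff_cos_le (n : nat) (t a : R) (k : Z) :
  0 <= t <= 1 -> Rabs (diff n (fun k => cos (t * IZR k + a)) k) <= t ^ n.
Proof.
  intros Ht. revert a; induction n as [|n IH]; intros a.
  - simpl. apply Rabs_le. pose proof (COS_bound (t * IZR k + a)). lra.
  - simpl diff. rewrite delta_cos, diff_scal, Rabs_mult. simpl pow.
    apply Rmult_le_compat; try apply Rabs_pos; [|apply IH].
    assert (0 <= sin (t / 2)) by (apply sin_ge_0; pose proof PI2_1; lra).
    rewrite Rabs_pos_eq by lra.
    destruct (Req_dec t 0) as [->|Ht0].
    + replace (0 / 2) with 0 by field. rewrite sin_0. lra.
    + assert (sin (t / 2) < t / 2) by (apply sin_lt_x; lra). lra.
Qed.

(** The integral of cos(t k) for t from 0 to [d], that is, half the Fourier transform of the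
    indicator of [-d, d]; the value at 0 is the limit. *)
Definition sinc (d : R) (k : Z) : R :=
  if Z.eq_dec k 0 then d else sin (d * IZR k) / IZR k.

Lemma is_RInt_sinc (d : R) (k : Z) :
  is_RInt (fun t => cos (t * IZR k + 0)) 0 d (sinc d k).
Proof.
  unfold sinc. destruct (Z.eq_dec k 0) as [->|Hk].
  - apply (is_RInt_ext (fun _ => 1)).
    + intros t _. now rewrite Rmult_0_r, Rplus_0_r, cos_0.
    + replace d with (scal (d - 0) 1) at 2 by (change ((d - 0) * 1 = d); ring).
      apply (is_RInt_const 0 d 1).
  - apply not_0_IZR in Hk.
    replace (sin (d * IZR k) / IZR k)
      with (minus (sin (d * IZR k + 0) / IZR k) (sin (0 * IZR k + 0) / IZR k)).
    + apply (is_RInt_derive (fun t => sin (t * IZR k + 0) / IZR k)).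
      * intros t _. auto_derive; [easy|]. now field.
      * intros t _. apply (ex_derive_continuous (fun t => cos (t * IZR k + 0))).
        now auto_derive.
    + change (sin (d * IZR k + 0) / IZR k - sin (0 * IZR k + 0) / IZR k
        = sin (d * IZR k) / IZR k).
      rewrite Rmult_0_l, !Rplus_0_r, sin_0. now field.
Qed.

Lemma is_RInt_diff (f : R -> Z -> R) (If : Z -> R) (a b : R) (n : nat) (k : Z) :
  (forall k, is_RInt (fun t => f t k) a b (If k)) ->
  is_RInt (fun t => diff n (f t) k) a b (diff n If k).
Proof.
  revert f If; induction n as [|n IH]; intros f If H; [apply H|].
  apply (IH (fun t => delta (f t))). intros j. now apply @is_RInt_minus.
Qed.

Lemma diff_sinc_le (d : R) (n : nat) (k : Z) :
  0 <= d <= 1 -> Rabs (diff n (sinc d) k) <= d * d ^ n.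
Proof.
  intros Hd.
  replace (d * d ^ n) with ((d - 0) * d ^ n) by ring.
  apply (norm_RInt_le_const (fun t => diff n (fun k => cos (t * IZR k + 0)) k) 0 d).
  - lra.
  - intros t Ht. apply Rle_trans with (t ^ n); [apply (diff_cos_le n t 0 k); lra|].
    apply pow_incr; lra.
  - apply (is_RInt_diff (fun t k => cos (t * IZR k + 0))). apply is_RInt_sinc.
Qed.

(** Since k sinc(k) = sin(d k), the commutator formula bounds the part weighted by |k| by (n + 1)
    d^n; with the unweighted part this is at most (n + 2) d^n. Doubling the rate absorbs the linear
    factor: n + 2 <= 2 * 2^n. *)
Lemma controlled_sinc (d : R) :
  0 <= d <= 1 -> controlled rho 2 (2 * d) (sinc d).
Proof.
  intros Hd n k.
  assert (Hsin : (fun j => IZR j * sinc d j) = (fun j => cos (d * IZR j + - (PI / 2)))).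
  { extensionality j. replace (d * IZR j + - (PI / 2)) with (- (PI / 2 - d * IZR j)) by ring.
    rewrite cos_neg, cos_shift. unfold sinc. destruct (Z.eq_dec j 0) as [->|Hj].
    - rewrite Rmult_0_r, sin_0. ring.
    - apply not_0_IZR in Hj. now field. }
  assert (H1 : Rabs (IZR k) * Rabs (diff n (sinc d) k) <= d ^ n + INR n * d ^ n).
  { rewrite <- Rabs_mult, mul_index_diff, Hsin.
    eapply Rle_trans; [apply Rabs_triang|]. apply Rplus_le_compat.
    - now apply diff_cos_le.
    - rewrite Rabs_Ropp, Rabs_mult, (Rabs_pos_eq (INR n)) by apply pos_INR.
      destruct n as [|n]; [simpl; lra|].
      apply Rmult_le_compat_l; [apply pos_INR|]. simpl pred. now apply diff_sinc_le. }
  pose proof (diff_sinc_le d n k Hd) as H2.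
  assert (Hd0 : 0 <= d ^ n) by (apply pow_le; lra).
  assert (H3 : d * d ^ n <= 1 * d ^ n) by (apply Rmult_le_compat_r; lra).
  assert (H4 : INR n + 2 <= 2 * 2 ^ n).
  { clear; induction n as [|n IH]; [simpl; lra|]. rewrite S_INR. simpl pow.
    pose proof (pos_INR n). lra. }
  rewrite Rpow_mult_distr. unfold rho.
  assert (H5 : (INR n + 2) * d ^ n <= 2 * 2 ^ n * d ^ n) by (now apply Rmult_le_compat_r).
  lra.
Qed.

(** Makes the rate of the P-th power small with [d], at fixed P. The base 5 closes the induction:
    the new terms 2 d + 2 d^2 5^P are at most 4 d 5^P. *)
Lemma pow_one_plus_le (d : R) (P : nat) :
  0 <= d <= 1 -> (1 + 2 * d) ^ P - 1 <= d * 5 ^ P.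
Proof.
  intros Hd; induction P as [|P IH]; [simpl; lra|]. simpl.
  assert (H5 : 1 <= 5 ^ P) by (apply pow_R1_Rle; lra).
  assert (H : (1 + 2 * d) * (1 + 2 * d) ^ P <= (1 + 2 * d) * (1 + d * 5 ^ P))
    by (apply Rmult_le_compat_l; lra).
  assert (0 <= d * (5 ^ P - 1)) by (apply Rmult_le_pos; lra).
  assert (0 <= d * 5 ^ P * (1 - d)) by (repeat apply Rmult_le_pos; lra).
  lra.
Qed.

(* [sinc d ^ (2 * P)] has Fourier transform a B-spline supported in
   [[- 2 P d, 2 P d]]: it decays polynomially and its iterated differences
   decrease like powers of an arbitrarily small number. *)
Lemma exists_band_limited (P : nat) (eps : R) :
  0 < eps ->
  exists (g : Z -> R) (K : R),
    (forall k, 0 <= g k) /\ 0 < g 0%Z /\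
    controlled (fun k => rho k ^ (2 * P)) K eps g.
Proof.
  intros He.
  (* The bound 1 is required by the sinc estimates; the quotient brings the rate of the power below
     [eps]. *)
  set (d := Rmin 1 (eps / 5 ^ (2 * P))).
  assert (H5 : 0 < 5 ^ (2 * P)) by (apply pow_lt; lra).
  assert (Hd : 0 < d <= 1).
  { split; [|apply Rmin_l]. apply Rmin_glb_lt; [lra|]. now apply Rdiv_lt_0_compat. }
  assert (Hde : (1 + 2 * d) ^ (2 * P) - 1 <= eps).
  { eapply Rle_trans; [apply pow_one_plus_le; lra|].
    apply Rle_trans with (eps / 5 ^ (2 * P) * 5 ^ (2 * P)).
    - apply Rmult_le_compat_r; [lra|]. apply Rmin_r.
    - right; field; lra. }
  assert (H0 : 0 <= (1 + 2 * d) ^ (2 * P) - 1).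
  { assert (1 <= (1 + 2 * d) ^ (2 * P)) by (apply pow_R1_Rle; lra). lra. }
  exists (fun k => sinc d k ^ (2 * P)), (2 ^ (2 * P)). split; [|split].
  - intros k. rewrite pow_mult. apply pow_le, pow2_ge_0.
  - unfold sinc; simpl. destruct (Z.eq_dec 0 0); [|easy]. apply pow_lt; lra.
  - intros n k. eapply Rle_trans.
    + apply (controlled_pow rho 2 (2 * d) (sinc d) (2 * P)).
      * intros j. pose proof (rho_ge1 j); lra.
      * apply controlled_sinc; lra.
    + apply Rmult_le_compat_l; [apply pow_le; lra|]. now apply pow_incr.
Qed.

(** * Difference operators *)

Lemma Cpowz_succ (z : C) (n : Z) :
  z <> RtoC 0 -> Cpowz z (n + 1) = (z * Cpowz z n)%C.
Proof.
  intros Hz.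
  assert (Hnat : forall i : nat, Cpowz z (Z.of_nat i) = Cpow z i).
  { intros [|i]; [reflexivity|].
    change (Cpow z (Pos.to_nat (Pos.of_succ_nat i)) = Cpow z (S i)).
    now rewrite SuccNat2Pos.id_succ. }
  assert (Hneg : forall i : nat, Cpowz z (- Z.of_nat i) = Cinv (Cpow z i)).
  { intros [|i].
    - simpl. unfold Cinv, RtoC; simpl. f_equal; field.
    - change (Cinv (Cpow z (Pos.to_nat (Pos.of_succ_nat i))) = Cinv (Cpow z (S i))).
      now rewrite SuccNat2Pos.id_succ. }
  destruct (Z_le_gt_dec 0 n) as [Hn|Hn].
  - rewrite <- (Z2Nat.id n Hn).
    replace (Z.of_nat (Z.to_nat n) + 1)%Z with (Z.of_nat (S (Z.to_nat n))) by lia.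
    now rewrite !Hnat.
  - replace n with (- Z.of_nat (S (Z.to_nat (- n - 1))))%Z by lia.
    set (i := Z.to_nat (- n - 1)).
    replace (- Z.of_nat (S i) + 1)%Z with (- Z.of_nat i)%Z by lia.
    rewrite !Hneg. simpl Cpow. field. split; [|exact Hz].
    now apply Cpow_nz.
Qed.

Lemma Cpowz_plus (z : C) (n k : Z) :
  z <> RtoC 0 -> Cpowz z (n + k) = (Cpowz z n * Cpowz z k)%C.
Proof.
  intros Hz. revert n. apply Z.bi_induction.
  - intros x y ->; tauto.
  - simpl. now rewrite Cmult_1_l.
  - intros n. unfold Z.succ.
    replace (n + 1 + k)%Z with (n + k + 1)%Z by lia.
    rewrite !Cpowz_succ by exact Hz. split; intros H.
    + rewrite H. ring.
    + apply (f_equal (Cmult (/ z))) in H.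
      transitivity (/ z * (z * Cpowz z (n + k)))%C; [now field|].
      rewrite H. now field.
Qed.

Lemma unit_circle_neq_0 (z : C) : unit_circle z -> z <> RtoC 0.
Proof. unfold unit_circle. intros Hz ->. rewrite Cmod_0 in Hz. lra. Qed.

Lemma Cmod_Cpowz (z : C) (n : Z) : unit_circle z -> Cmod (Cpowz z n) = 1.
Proof.
  intros Hz. pose proof (unit_circle_neq_0 z Hz) as H0.
  unfold unit_circle in Hz. revert n. apply Z.bi_induction.
  - intros x y ->; tauto.
  - apply Cmod_1.
  - intros n. unfold Z.succ. rewrite Cpowz_succ, Cmod_mult, Hz by exact H0.
    rewrite Rmult_1_l. tauto.
Qed.

Lemma opB_S {X : NormedModule C_AbsRing} (m : nat) (b : nat -> C) (nu : nat -> Z)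
    (u : Z -> X) (k : Z) :
  opB (S m) b nu u k = plus (opB m b nu u k) (scal (b (S m)) (u (k + nu (S m))%Z)).
Proof. unfold opB. now rewrite sum_Sn. Qed.

Lemma opB_0 {X : NormedModule C_AbsRing} (b : nat -> C) (nu : nat -> Z)
    (u : Z -> X) (k : Z) :
  opB 0 b nu u k = scal (b 0%nat) (u (k + nu 0%nat)%Z).
Proof. unfold opB. now rewrite sum_O. Qed.

(* Modulation turns [opB] with coefficients [b] into [opB] with coefficients
   [b j * zeta ^ nu j], whose sum is [p_B(zeta)]. *)
Lemma opB_modulate (m : nat) (b : nat -> C) (nu : nat -> Z) (z : C) (u : Z -> C) (k : Z) :
  z <> RtoC 0 ->
  opB (X := C_NormedModule) m b nu (fun k => Cmult (Cpowz z k) (u k)) k =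
  Cmult (Cpowz z k)
    (opB (X := C_NormedModule) m (fun j => Cmult (b j) (Cpowz z (nu j))) nu u k).
Proof.
  intros Hz. induction m as [|m IH].
  - rewrite !opB_0. change scal with Cmult. simpl. rewrite Cpowz_plus by exact Hz.
    change scal with Cmult. ring.
  - rewrite !opB_S, IH. rewrite Cpowz_plus by exact Hz.
    change (Cplus (Cpowz z k * opB (X := C_NormedModule) m
       (fun j => Cmult (b j) (Cpowz z (nu j))) nu u k)
     (b (S m) * ((Cpowz z k * Cpowz z (nu (S m))) * u (k + nu (S m))%Z)) =
     Cpowz z k * Cplus (opB (X := C_NormedModule) m
       (fun j => Cmult (b j) (Cpowz z (nu j))) nu u k)
       (b (S m) * Cpowz z (nu (S m)) * u (k + nu (S m))%Z))%C.
    ring.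
Qed.

Lemma delta_opB (m : nat) (c : nat -> C) (nu : nat -> Z) (u : Z -> C) :
  delta (G := C_AbelianGroup) (opB (X := C_NormedModule) m c nu u) =
  opB (X := C_NormedModule) m c nu (delta (G := C_AbelianGroup) u).
Proof.
  extensionality k. induction m as [|m IH].
  - unfold delta at 1. rewrite !opB_0.
    replace (k + 1 + nu 0%nat)%Z with (k + nu 0%nat + 1)%Z by lia.
    change (c 0%nat * u (k + nu 0%nat + 1)%Z - c 0%nat * u (k + nu 0%nat)%Z =
      c 0%nat * (u (k + nu 0%nat + 1)%Z - u (k + nu 0%nat)%Z))%C. ring.
  - unfold delta at 1. rewrite !opB_S, <- IH. unfold delta at 1.
    set (U := opB (X := C_NormedModule) m c nu u).
    replace (k + 1 + nu (S m))%Z with (k + nu (S m) + 1)%Z by lia.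
    change ((U (k + 1)%Z + c (S m) * u (k + nu (S m) + 1)%Z)
      - (U k + c (S m) * u (k + nu (S m))%Z) =
      (U (k + 1)%Z - U k) + c (S m) * (u (k + nu (S m) + 1)%Z - u (k + nu (S m))%Z))%C.
    ring.
Qed.

Lemma diff_opB (n m : nat) (c : nat -> C) (nu : nat -> Z) (u : Z -> C) :
  diff (G := C_AbelianGroup) n (opB (X := C_NormedModule) m c nu u) =
  opB (X := C_NormedModule) m c nu (diff (G := C_AbelianGroup) n u).
Proof.
  revert u; induction n as [|n IH]; intros u; [reflexivity|]. simpl.
  now rewrite delta_opB, IH.
Qed.

(** Isolates what the difference estimates use, so that they apply to [w k * rho k ^ 3] rather than
    to [w] alone. *)
Record submult_weight (p : Z -> R) : Prop := {
  sw_ge1 : forall t, 1 <= p t;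
  sw_submult : forall s t, p (s + t)%Z <= p s * p t;
  sw_sym : forall t, p (- t)%Z = p t
}.

Section WeightedDifferences.

Context (p : Z -> R) (hp : submult_weight p).

Lemma sw_shift (h k : Z) : p k <= p h * p (k + h)%Z.
Proof.
  rewrite <- (sw_sym p hp h), Rmult_comm.
  eapply Rle_trans; [|apply (sw_submult p hp)]. right; f_equal; lia.
Qed.

(** Telescoping over unit steps: the difference taken at k + i costs a factor [p i] when weighed at
    k. [D] is chosen before [u], which later permits choosing the test function after [D]. *)
Lemma translate_nat_sub_le (h : nat) :
  exists D : R, 0 <= D /\ forall (u : Z -> C) (E : R),
    (forall k, p k * Cmod (delta (G := C_AbelianGroup) u k) <= E) ->
    forall k, p k * Cmod (u (k + Z.of_nat h)%Z - u k)%C <= D * E.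
Proof.
  induction h as [|h (D & HD & IH)].
  - exists 0. split; [lra|]. intros u E _ k.
    replace (k + Z.of_nat 0)%Z with k by lia.
    replace (u k - u k)%C with (RtoC 0) by ring. rewrite Cmod_0. lra.
  - exists (p (Z.of_nat h) + D). split; [pose proof (sw_ge1 p hp (Z.of_nat h)); lra|].
    intros u E Hu k. specialize (IH u E Hu k).
    set (j := (k + Z.of_nat h)%Z) in *.
    replace (k + Z.of_nat (S h))%Z with (j + 1)%Z by (unfold j; lia).
    pose proof (sw_shift (Z.of_nat h) k) as Hs. fold j in Hs.
    specialize (Hu j). change (p j * Cmod (u (j + 1)%Z - u j)%C <= E) in Hu.
    pose proof (sw_ge1 p hp (Z.of_nat h)). pose proof (sw_ge1 p hp k).
    replace (u (j + 1)%Z - u k)%C with ((u (j + 1)%Z - u j) + (u j - u k))%C by ring.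
    pose proof (Cmod_triangle (u (j + 1)%Z - u j)%C (u j - u k)%C) as Ht.
    apply (Rmult_le_compat_l (p k)) in Ht; [|lra].
    assert (p k * Cmod (u (j + 1)%Z - u j)%C <= p (Z.of_nat h) * E).
    { apply Rle_trans with (p (Z.of_nat h) * p j * Cmod (u (j + 1)%Z - u j)%C).
      - apply Rmult_le_compat_r; [apply Cmod_ge_0|exact Hs].
      - rewrite Rmult_assoc. apply Rmult_le_compat_l; lra. }
    lra.
Qed.

Lemma translate_sub_le (h : Z) :
  exists D : R, 0 <= D /\ forall (u : Z -> C) (E : R),
    (forall k, p k * Cmod (delta (G := C_AbelianGroup) u k) <= E) ->
    forall k, p k * Cmod (u (k + h)%Z - u k)%C <= D * E.
Proof.
  destruct (translate_nat_sub_le (Z.to_nat (Z.abs h))) as (D & HD & H).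
  pose proof (sw_ge1 p hp h) as Hh.
  exists (p h * D). split; [apply Rmult_le_pos; lra|].
  intros u E Hu k.
  assert (HDE : 0 <= D * E).
  { eapply Rle_trans; [|apply (H u E Hu k)].
    apply Rmult_le_pos; [pose proof (sw_ge1 p hp k); lra|apply Cmod_ge_0]. }
  destruct (Z_le_gt_dec 0 h) as [Hn|Hn].
  - specialize (H u E Hu k).
    replace (k + Z.of_nat (Z.to_nat (Z.abs h)))%Z with (k + h)%Z in H by lia. nra.
  (* For negative [h] the same difference is read from the base point k + h; returning the weight to
     k costs [p h]. *)
  - specialize (H u E Hu (k + h)%Z).
    replace (k + h + Z.of_nat (Z.to_nat (Z.abs h)))%Z with k in H by lia.
    pose proof (sw_shift h k).
    replace (u (k + h)%Z - u k)%C with (- (u k - u (k + h)%Z))%C by ring.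
    rewrite Cmod_opp.
    apply Rle_trans with (p h * p (k + h)%Z * Cmod (u k - u (k + h)%Z)%C).
    + apply Rmult_le_compat_r; [apply Cmod_ge_0|assumption].
    + rewrite !Rmult_assoc. apply Rmult_le_compat_l; lra.
Qed.

(** Removing the sum of the coefficients leaves terms c_j (u(k + nu_j) - u(k)), each controlled by
    [delta u]. *)
Lemma opB_sub_le (m : nat) (c : nat -> C) (nu : nat -> Z) :
  exists D : R, 0 <= D /\ forall (u : Z -> C) (E : R),
    (forall k, p k * Cmod (delta (G := C_AbelianGroup) u k) <= E) ->
    forall k, p k * Cmod (opB (X := C_NormedModule) m c nu u k - sum_n c m * u k)%C <= D * E.
Proof.
  induction m as [|m (D & HD & IH)].
  - destruct (translate_sub_le (nu 0%nat)) as (D & HD & H).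
    exists (Cmod (c 0%nat) * D). split; [apply Rmult_le_pos; auto using Cmod_ge_0|].
    intros u E Hu k. specialize (H u E Hu k).
    rewrite opB_0, sum_O. change (scal (c 0%nat) ?x) with (c 0%nat * x)%C.
    replace (c 0%nat * u (k + nu 0%nat)%Z - c 0%nat * u k)%C
      with (c 0%nat * (u (k + nu 0%nat)%Z - u k))%C by ring.
    rewrite Cmod_mult. pose proof (Cmod_ge_0 (c 0%nat)). nra.
  - destruct (translate_sub_le (nu (S m))) as (D' & HD' & H).
    exists (D + Cmod (c (S m)) * D').
    split; [apply Rplus_le_le_0_compat, Rmult_le_pos; auto using Cmod_ge_0|].
    intros u E Hu k. specialize (H u E Hu k). specialize (IH u E Hu k).
    rewrite opB_S, sum_Sn.
    set (U := opB (X := C_NormedModule) m c nu u k) in *.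
    change (p k * Cmod (U + c (S m) * u (k + nu (S m))%Z - (sum_n c m + c (S m)) * u k)%C
      <= (D + Cmod (c (S m)) * D') * E).
    replace (U + c (S m) * u (k + nu (S m))%Z - (sum_n c m + c (S m)) * u k)%C
      with ((U - sum_n c m * u k) + c (S m) * (u (k + nu (S m))%Z - u k))%C by ring.
    pose proof (sw_ge1 p hp k).
    pose proof (Cmod_triangle (U - sum_n c m * u k)%C
      (c (S m) * (u (k + nu (S m))%Z - u k))%C) as Ht.
    rewrite Cmod_mult in Ht. pose proof (Cmod_ge_0 (c (S m))).
    apply (Rmult_le_compat_l (p k)) in Ht; [|lra]. nra.
Qed.

(** With zero coefficient sum, one application of [opB] costs [D] and one extra difference. As [opB]
    commutes with [diff], [opB u] satisfies the same hypothesis with constant [K * D * eps], so the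
    induction generalises over [u] and [K]. *)
Lemma iter_opB_le (m : nat) (c : nat -> C) (nu : nat -> Z) :
  sum_n c m = RtoC 0 ->
  exists D : R, 0 <= D /\ forall (u : Z -> C) (K eps : R),
    (forall n k, p k * Cmod (diff (G := C_AbelianGroup) n u k) <= K * eps ^ n) ->
    forall n k, p k * Cmod (Nat.iter n (opB (X := C_NormedModule) m c nu) u k)
      <= K * (D * eps) ^ n.
Proof.
  intros Hc. destruct (opB_sub_le m c nu) as (D & HD & H).
  exists D. split; [exact HD|].
  intros u K eps Hu n k. revert K u Hu k; induction n as [|n IH]; intros K u Hu k.
  - apply (Hu 0%nat).
  - rewrite Nat.iter_succ_r. simpl pow.
    replace (K * (D * eps * (D * eps) ^ n)) with (K * D * eps * (D * eps) ^ n) by ring.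
    apply IH. clear n k IH. intros n k. rewrite diff_opB.
    replace (K * D * eps * eps ^ n) with (D * (K * eps ^ S n)) by (simpl; ring).
    specialize (H (diff (G := C_AbelianGroup) n u) (K * eps ^ S n)).
    rewrite Hc in H.
    (* Here [delta] is outermost, whereas [diff] unfolds innermost; the two orders are identified by
       induction. *)
    assert (Hd : forall k, p k * Cmod (delta (G := C_AbelianGroup)
        (diff (G := C_AbelianGroup) n u) k) <= K * eps ^ S n).
    { intros j. eapply Rle_trans; [right|apply Hu]. f_equal; f_equal.
      clear. revert u; induction n as [|n IH]; intros u; [reflexivity|]. apply (IH (delta u)). }
    specialize (H Hd k).
    assert (E : forall x y : C, (x - RtoC 0 * y)%C = x) by (intros; ring).
    now rewrite E in H.
Qed.

End WeightedDifferences.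

(** * Convolutions *)

Section WeightFacts.

Context (w : Z -> R) (hw : is_weight w).

(** Polynomial growth is only asymptotic. Below the threshold [M], submultiplicativity bounds [w] by
    [w 0 * w 1 ^ M]; the constant adds this to the 2 from 1 + |k|^(N+1) <= 2 rho^(N+1). *)
Lemma weight_rho_pow_le (hg : polynomial_growth w) :
  exists (n : nat) (c : R), forall k, w k <= c * rho k ^ n.
Proof.
  destruct hg as [N [Hlim _]].
  destruct (Hlim 1%Z 1 Rlt_0_1) as [M HM].
  pose proof (weight_ge1 w hw) as H1. pose proof (weight_submult w hw) as Hs.
  pose proof (weight_sym w hw) as Hy.
  assert (Hnat : forall i : nat, w (Z.of_nat i) <= w 0%Z * w 1%Z ^ i).
  { induction i as [|i IH]; [simpl; lra|].
    replace (Z.of_nat (S i)) with (Z.of_nat i + 1)%Z by lia.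
    eapply Rle_trans; [apply Hs|]. simpl. pose proof (H1 1%Z). nra. }
  assert (Habs : forall k, w k <= w 0%Z * w 1%Z ^ Z.to_nat (Z.abs k)).
  { intros k. eapply Rle_trans; [|apply Hnat]. right.
    destruct (Z_le_gt_dec 0 k); [f_equal; lia|]. rewrite <- Hy. f_equal; lia. }
  exists (N + 1)%nat, (2 + w 0%Z * w 1%Z ^ Z.to_nat M). intros k.
  pose proof (rho_ge1 k) as Hr.
  assert (Hr1 : 1 <= rho k ^ (N + 1)) by (apply pow_R1_Rle; lra).
  assert (Hw1 : 0 < w 0%Z * w 1%Z ^ Z.to_nat M).
  { apply Rmult_lt_0_compat; [pose proof (H1 0%Z); lra|].
    apply pow_lt. pose proof (H1 1%Z); lra. }
  destruct (Z_le_gt_dec M (Z.abs k)) as [Hk|Hk].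
  - specialize (HM k Hk). rewrite Z.mul_1_r in HM.
    assert (Hp : 0 <= Rabs (IZR k) ^ (N + 1)) by (apply pow_le, Rabs_pos).
    assert (Hle : Rabs (IZR k) ^ (N + 1) <= rho k ^ (N + 1)).
    { apply pow_incr. unfold rho. pose proof (Rabs_pos (IZR k)). lra. }
    apply Rabs_def2 in HM. destruct HM as [HM _].
    apply (Rmult_lt_compat_r (1 + Rabs (IZR k) ^ (N + 1))) in HM; [|lra].
    unfold Rdiv in HM. rewrite Rmult_assoc, Rinv_l in HM by lra. nra.
  - apply Rle_trans with (w 0%Z * w 1%Z ^ Z.to_nat M).
    + eapply Rle_trans; [apply Habs|]. apply Rmult_le_compat_l; [pose proof (H1 0%Z); lra|].
      apply Rle_pow; [apply H1|lia].
    + nra.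
Qed.

Lemma weight_rho_submult (n : nat) : submult_weight (fun k => w k * rho k ^ n).
Proof.
  pose proof (weight_ge1 w hw) as H1.
  assert (Hr : forall k, 1 <= rho k ^ n) by (intros k; apply pow_R1_Rle, rho_ge1).
  split.
  - intros t. specialize (H1 t). specialize (Hr t). nra.
  - intros s t. replace (w s * rho s ^ n * (w t * rho t ^ n))
      with ((w s * w t) * (rho s * rho t) ^ n) by (rewrite Rpow_mult_distr; ring).
    apply Rmult_le_compat.
    + specialize (H1 (s + t)%Z); lra.
    + specialize (Hr (s + t)%Z); lra.
    + apply (weight_submult w hw).
    + apply pow_incr. split; [|apply rho_submult]. pose proof (rho_ge1 (s + t)); lra.
  - intros t. now rewrite (weight_sym w hw), rho_sym.
Qed.

End WeightFacts.

(** Exponent 2 suffices for summability; exponent 3 leaves one power to spend on truncation. The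
    constant is explicit because its geometric decrease along iterates is what matters. *)
Definition decays (w : Z -> R) (r : nat) (K : R) (f : Z -> C) : Prop :=
  forall k, w k * rho k ^ r * Cmod (f k) <= K.

Section Convolution.

Context {X : CompleteNormedModule C_AbsRing} (w : Z -> R) (hw : is_weight w).

Definition bounded_by (M : R) (phi : Z -> X) : Prop := forall t, norm (phi t) <= M * w t.

Lemma BUC_bounded_by (phi : Z -> X) : BUC w phi -> exists M, bounded_by M phi.
Proof.
  intros [M HM]. exists M. intros t. specialize (HM t).
  pose proof (weight_ge1 w hw t).
  apply (Rmult_le_compat_r (w t)) in HM; [|lra].
  unfold Rdiv in HM. now rewrite Rmult_assoc, Rinv_l, Rmult_1_r in HM by lra.
Qed.

Lemma bounded_by_BUC (M : R) (phi : Z -> X) : bounded_by M phi -> BUC w phi.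
Proof.
  intros HM. exists M. intros t. specialize (HM t).
  pose proof (weight_ge1 w hw t).
  apply Rle_div_l; [lra|exact HM].
Qed.

Lemma bounded_by_nonneg (M : R) (phi : Z -> X) : bounded_by M phi -> 0 <= M.
Proof.
  intros HM. specialize (HM 0%Z). pose proof (norm_ge_0 (phi 0%Z)).
  pose proof (weight_ge1 w hw 0%Z). nra.
Qed.

Lemma decays_nonneg (r : nat) (K : R) (f : Z -> C) : decays w r K f -> 0 <= K.
Proof.
  intros H. eapply Rle_trans; [|apply (H 0%Z)].
  pose proof (weight_ge1 w hw 0%Z). pose proof (rho_ge1 0).
  repeat apply Rmult_le_pos; auto using Cmod_ge_0; try lra. apply pow_le; lra.
Qed.

Lemma decays_pred (r : nat) (K : R) (f : Z -> C) : decays w (S r) K f -> decays w r K f.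
Proof.
  intros H k. eapply Rle_trans; [|apply (H k)]. simpl.
  pose proof (weight_ge1 w hw k). pose proof (rho_ge1 k).
  assert (0 <= rho k ^ r) by (apply pow_le; lra).
  apply Rmult_le_compat_r; [apply Cmod_ge_0|]. apply Rmult_le_compat_l; nra.
Qed.

Lemma L1_decays (K : R) (f : Z -> C) : decays w 2 K f -> L1 w f.
Proof.
  intros Hf.
  destruct (is_sumZ_dominated (V := R_CompleteNormedModule)
    (fun k => Cmod (f k) * w k) K) as (s & Hs & _); [|now exists s].
  intros k. pose proof (rho_ge1 k). pose proof (weight_ge1 w hw k).
  change (Rabs (Cmod (f k) * w k) <= K / rho k ^ 2).
  rewrite Rabs_pos_eq by (apply Rmult_le_pos; [apply Cmod_ge_0|lra]).
  apply (proj1 (Rle_div_r _ _ _ (pow_lt (rho k) 2 ltac:(lra)))). specialize (Hf k). lra.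
Qed.

(** In w(n - k) <= w(n) w(k) the factor w(k) is absorbed by the decay of [f], and w(n) remains as
    the weight of the result. *)
Lemma conv_exists (phi : Z -> X) (f : Z -> C) (M K : R) (n : Z) :
  bounded_by M phi -> decays w 2 K f ->
  is_sumZ (fun k => scal (f k) (phi (n - k)%Z)) (conv phi f n) /\
  norm (conv phi f n) <= 4 * (M * K) * w n.
Proof.
  intros Hphi Hf.
  destruct (is_sumZ_dominated (V := X) (fun k => scal (f k) (phi (n - k)%Z)) (M * K * w n))
    as (s & Hs & Hn).
  - intros k. eapply Rle_trans; [exact (norm_scal (f k) (phi (n - k)%Z))|].
    change (Cmod (f k) * norm (phi (n - k)%Z) <= M * K * w n / rho k ^ 2).
    pose proof (rho_ge1 k). pose proof (bounded_by_nonneg M phi Hphi) as HM.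
    apply (proj1 (Rle_div_r _ _ _ (pow_lt (rho k) 2 ltac:(lra)))).
    pose proof (weight_ge1 w hw n) as Hwn. pose proof (weight_ge1 w hw k).
    assert (Hw : w (n - k)%Z <= w n * w k).
    { rewrite <- (weight_sym w hw k). apply (weight_submult w hw). }
    specialize (Hphi (n - k)%Z). specialize (Hf k).
    pose proof (Cmod_ge_0 (f k)) as Hc.
    assert (Hr : 0 <= rho k ^ 2) by (apply pow_le; lra).
    apply Rle_trans with (Cmod (f k) * (M * (w n * w k)) * rho k ^ 2).
    + apply Rmult_le_compat_r; [exact Hr|]. apply Rmult_le_compat_l; [exact Hc|].
      eapply Rle_trans; [exact Hphi|]. now apply Rmult_le_compat_l.
    + replace (Cmod (f k) * (M * (w n * w k)) * rho k ^ 2)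
        with (M * w n * (w k * rho k ^ 2 * Cmod (f k))) by ring.
      replace (M * K * w n) with (M * w n * K) by ring.
      apply Rmult_le_compat_l; [|exact Hf]. apply Rmult_le_pos; lra.
  - assert (E : conv phi f n = s) by (apply sumZ_unique; exact Hs).
    rewrite E. split; [exact Hs|]. lra.
Qed.

Lemma conv_unique (phi : Z -> X) (f : Z -> C) (n : Z) (s : X) :
  is_sumZ (fun k => scal (f k) (phi (n - k)%Z)) s -> conv phi f n = s.
Proof. apply sumZ_unique. Qed.

Lemma conv_plus_l (phi chi : Z -> X) (f : Z -> C) (M M' K : R) (n : Z) :
  bounded_by M phi -> bounded_by M' chi -> decays w 2 K f ->
  conv (fun t => plus (phi t) (chi t)) f n = plus (conv phi f n) (conv chi f n).
Proof.
  intros Hphi Hchi Hf. apply conv_unique.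
  eapply is_sumZ_ext; [|exact (is_sumZ_plus _ _ _ _
    (proj1 (conv_exists phi f M K n Hphi Hf)) (proj1 (conv_exists chi f M' K n Hchi Hf)))].
  intros k. symmetry. exact (scal_distr_l (f k) (phi (n - k)%Z) (chi (n - k)%Z)).
Qed.

Lemma conv_plus_r (phi : Z -> X) (f g : Z -> C) (M K K' : R) (n : Z) :
  bounded_by M phi -> decays w 2 K f -> decays w 2 K' g ->
  conv phi (fun k => Cplus (f k) (g k)) n = plus (conv phi f n) (conv phi g n).
Proof.
  intros Hphi Hf Hg. apply conv_unique.
  eapply is_sumZ_ext; [|exact (is_sumZ_plus _ _ _ _
    (proj1 (conv_exists phi f M K n Hphi Hf)) (proj1 (conv_exists phi g M K' n Hphi Hg)))].
  intros k. symmetry. exact (scal_distr_r (f k) (g k) (phi (n - k)%Z)).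
Qed.

Lemma conv_linear (U : X -> X) (phi : Z -> X) (f : Z -> C) (M K : R) (n : Z) :
  is_linear U -> bounded_by M phi -> decays w 2 K f ->
  conv (fun t => U (phi t)) f n = U (conv phi f n).
Proof.
  intros HU Hphi Hf. apply conv_unique.
  eapply is_sumZ_ext; [|exact (is_sumZ_linear U _ _ HU (proj1 (conv_exists phi f M K n Hphi Hf)))].
  intros k. exact (linear_scal U HU (f k) (phi (n - k)%Z)).
Qed.

Lemma conv_single (phi : Z -> X) (f : Z -> C) (k0 n : Z) :
  (forall k, k <> k0 -> f k = RtoC 0) -> conv phi f n = scal (f k0) (phi (n - k0)%Z).
Proof.
  intros H0. apply conv_unique.
  apply (is_sumZ_single (fun k => scal (f k) (phi (n - k)%Z))).
  intros k Hk. rewrite (H0 k Hk). exact (scal_zero_l (phi (n - k)%Z)).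
Qed.

Lemma scal_scal_comm (a b : C) (x : X) : scal a (scal b x) = scal b (scal a x).
Proof.
  rewrite !scal_assoc. f_equal. exact (Cmult_comm a b).
Qed.

(** As [phi] is taken at n - k, reindexing puts each shift on [f] with the same sign: the same
    operator, not its reflection, acts on [f]. The sums used are those at the points n + nu_j, hence
    the hypothesis at every [j]. *)
Lemma is_sumZ_conv_opB (m : nat) (b : nat -> C) (nu : nat -> Z) (phi : Z -> X) (f : Z -> C)
  (n : Z) :
  (forall j, exists s, is_sumZ (fun k => scal (f k) (phi (j - k)%Z)) s) ->
  exists s,
    is_sumZ (fun k => scal (f k) (opB m b nu phi (n - k)%Z)) s /\
    is_sumZ (fun k => scal (opB (X := C_NormedModule) m b nu f k) (phi (n - k)%Z)) s.
Proof.
  intros H.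
  assert (Hterm : forall j, exists s,
    is_sumZ (fun k => scal (f k) (scal (b j) (phi (n - k + nu j)%Z))) s /\
    is_sumZ (fun k => scal (Cmult (b j) (f (k + nu j)%Z)) (phi (n - k)%Z)) s).
  { intros j. destruct (H (n + nu j)%Z) as [s Hs].
    apply (is_sumZ_scal (b j)) in Hs. exists (scal (b j) s). split.
    - revert Hs. apply is_sumZ_ext. intros k. rewrite scal_scal_comm.
      do 3 f_equal. lia.
    - apply (is_sumZ_translate (nu j)) in Hs. revert Hs. apply is_sumZ_ext. intros k.
      replace (n + nu j - (k + nu j))%Z with (n - k)%Z by lia.
      exact (scal_assoc (b j) (f (k + nu j)%Z) (phi (n - k)%Z)). }
  induction m as [|m (s & IH1 & IH2)].
  - destruct (Hterm 0%nat) as (s & H1 & H2). exists s. split.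
    + revert H1. apply is_sumZ_ext. intros k. now rewrite opB_0.
    + revert H2. apply is_sumZ_ext. intros k. now rewrite opB_0.
  - destruct (Hterm (S m)) as (s' & H1 & H2). exists (plus s s'). split.
    + eapply is_sumZ_ext; [|exact (is_sumZ_plus _ _ _ _ IH1 H1)].
      intros k. rewrite opB_S. symmetry. exact (scal_distr_l (f k) _ _).
    + eapply is_sumZ_ext; [|exact (is_sumZ_plus _ _ _ _ IH2 H2)].
      intros k. rewrite opB_S. symmetry. exact (scal_distr_r (K := C_Ring) _ _ (phi (n - k)%Z)).
Qed.

Lemma conv_opB (m : nat) (b : nat -> C) (nu : nat -> Z) (phi : Z -> X) (f : Z -> C)
  (M K : R) (n : Z) :
  bounded_by M phi -> decays w 2 K f ->
  conv (opB m b nu phi) f n = conv phi (opB (X := C_NormedModule) m b nu f) n.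
Proof.
  intros Hphi Hf.
  destruct (is_sumZ_conv_opB m b nu phi f n) as (s & H1 & H2).
  - intros j. exists (conv phi f j). apply (conv_exists phi f M K j Hphi Hf).
  - now rewrite (conv_unique _ _ _ _ H1), (conv_unique _ _ _ _ H2).
Qed.

Lemma opB_bounded_by (m : nat) (b : nat -> C) (nu : nat -> Z) (phi : Z -> X) (M : R) :
  bounded_by M phi -> exists M', bounded_by M' (opB m b nu phi).
Proof.
  intros Hphi. pose proof (bounded_by_nonneg M phi Hphi) as HM.
  assert (Hterm : forall j, bounded_by (Cmod (b j) * (M * w (nu j)))
    (fun k => scal (b j) (phi (k + nu j)%Z))).
  { intros j k. eapply Rle_trans; [exact (norm_scal (b j) (phi (k + nu j)%Z))|].
    change (Cmod (b j) * norm (phi (k + nu j)%Z) <= Cmod (b j) * (M * w (nu j)) * w k).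
    rewrite Rmult_assoc. apply Rmult_le_compat_l; [apply Cmod_ge_0|].
    eapply Rle_trans; [apply Hphi|]. rewrite Rmult_assoc. apply Rmult_le_compat_l; [exact HM|].
    rewrite (Rmult_comm (w (nu j))). apply (weight_submult w hw). }
  induction m as [|m [M' IH]].
  - exists (Cmod (b 0%nat) * (M * w (nu 0%nat))). intros k. rewrite opB_0. apply Hterm.
  - exists (M' + Cmod (b (S m)) * (M * w (nu (S m)))). intros k. rewrite opB_S.
    eapply Rle_trans; [apply norm_triangle|]. rewrite Rmult_plus_distr_r.
    apply Rplus_le_compat; [apply IH|apply Hterm].
Qed.

Lemma linear_bounded_by (U : X -> X) (phi : Z -> X) (M : R) :
  is_linear U -> bounded_by M phi -> exists M', bounded_by M' (fun t => U (phi t)).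
Proof.
  intros [_ _ [B [HB HU]]] Hphi. exists (B * M). intros t.
  eapply Rle_trans; [apply HU|]. rewrite Rmult_assoc. apply Rmult_le_compat_l; [lra|apply Hphi].
Qed.

Lemma iter_bounded_by (U : X -> X) (m : nat) (b : nat -> C) (nu : nat -> Z)
  (phi : Z -> X) (M : R) (n : nat) :
  is_linear U -> bounded_by M phi ->
  exists M', bounded_by M' (Nat.iter n (fun chi t => U (opB m b nu chi t)) phi).
Proof.
  intros HU Hphi; induction n as [|n [M' IH]]; [now exists M|]. simpl.
  destruct (opB_bounded_by m b nu _ M' IH) as [M'' H].
  exact (linear_bounded_by U _ M'' HU H).
Qed.

(** [U] leaves the convolution at the cost of [B], and its [opB] passes to [f]. The induction
    continues with [opB f], so decay of all iterates is assumed. *)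
Lemma norm_conv_iter_le (U : X -> X) (B : R) (m : nat) (b : nat -> C) (nu : nat -> Z)
  (phi : Z -> X) (M : R) (n : nat) (f : Z -> C) (t : Z) :
  is_linear U -> 0 <= B -> (forall x, norm (U x) <= B * norm x) -> bounded_by M phi ->
  (forall j, exists K, decays w 2 K (Nat.iter j (opB (X := C_NormedModule) m b nu) f)) ->
  norm (conv (Nat.iter n (fun chi t => U (opB m b nu chi t)) phi) f t) <=
  B ^ n * norm (conv phi (Nat.iter n (opB (X := C_NormedModule) m b nu) f) t).
Proof.
  intros HU HB HUB Hphi. revert f; induction n as [|n IH]; intros f Hf; [simpl; lra|].
  rewrite (Nat.iter_succ_r _ _ _ f). simpl pow.
  set (phin := Nat.iter n (fun chi t => U (opB m b nu chi t)) phi) in *.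
  change (norm (conv (fun t => U (opB m b nu phin t)) f t) <= B * B ^ n *
    norm (conv phi (Nat.iter n (opB (X := C_NormedModule) m b nu)
      (opB (X := C_NormedModule) m b nu f)) t)).
  destruct (iter_bounded_by U m b nu phi M n HU Hphi) as [M' HM']. fold phin in HM'.
  destruct (opB_bounded_by m b nu _ M' HM') as [M'' HM''].
  destruct (Hf 0%nat) as [K HK]. simpl in HK.
  rewrite (conv_linear U _ f M'' K t HU HM'' HK), (conv_opB m b nu _ f M' K t HM' HK).
  eapply Rle_trans; [apply HUB|]. rewrite Rmult_assoc. apply Rmult_le_compat_l; [exact HB|].
  apply IH. intros j. rewrite <- Nat.iter_succ_r. apply Hf.
Qed.

End Convolution.

(** * The restricted class *)

(** [real] sends an infinite supremum to 0. For empty [T] it is minus infinity, which is where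
    [0 <= B] enters. *)
Lemma wnorm_le {K : AbsRing} {X : NormedModule K} {T : Type} (w : T -> R) (phi : T -> X) (B : R) :
  0 <= B -> (forall t, norm (phi t) / w t <= B) -> wnorm w phi <= B.
Proof.
  intros HB H. unfold wnorm.
  set (E := fun r => exists t : T, r = norm (phi t) / w t).
  destruct (Lub_Rbar_correct E) as [_ Hl].
  assert (Hle : Rbar_le (Lub_Rbar E) B).
  { apply Hl. intros r [t ->]. apply H. }
  destruct (Lub_Rbar E); simpl in *; lra || contradiction.
Qed.

Lemma opB_plus {X : NormedModule C_AbsRing} (m : nat) (b : nat -> C) (nu : nat -> Z)
  (u v : Z -> X) (k : Z) :
  opB m b nu (fun t => plus (u t) (v t)) k = plus (opB m b nu u k) (opB m b nu v k).
Proof.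
  induction m as [|m IH].
  - rewrite !opB_0. exact (scal_distr_l (b 0%nat) (u _) (v _)).
  - rewrite !opB_S, IH, plus_plus_swap. f_equal. exact (scal_distr_l (b (S m)) (u _) (v _)).
Qed.

Section RestrictedClass.

Context {X : CompleteNormedModule C_AbsRing} (w : Z -> R) (hw : is_weight w)
  (J : index_set) (F : (elt J -> X) -> Prop) (hF : admissible_class w J F).

(** [F] sees only functions on [J], while shifts and convolutions need values on all of Z;
    translation by any integer is granted only to restrictions of bounded functions on Z. *)
Definition class_on_Z (chi : Z -> X) : Prop :=
  (exists M, bounded_by w M chi) /\ F (restrict J chi).

Lemma class_ext (chi chi' : Z -> X) :
  (forall t, chi t = chi' t) -> class_on_Z chi -> class_on_Z chi'.
Proof. intros E. apply functional_extensionality in E. now subst. Qed.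

Lemma class_zero : class_on_Z (fun _ => zero).
Proof.
  destruct hF as [(_ & H0 & _) _]. split; [|exact H0].
  exists 0. intros t. eapply Rle_trans; [right; exact (@norm_zero C_AbsRing X)|lra].
Qed.

Lemma class_plus (phi chi : Z -> X) :
  class_on_Z phi -> class_on_Z chi -> class_on_Z (fun t => plus (phi t) (chi t)).
Proof.
  destruct hF as [(_ & _ & Hp & _) _].
  intros [[M HM] H1] [[M' HM'] H2]. split; [|exact (Hp _ _ H1 H2)].
  exists (M + M'). intros t. eapply Rle_trans; [exact (norm_triangle (phi t) (chi t))|].
  rewrite Rmult_plus_distr_r. now apply Rplus_le_compat.
Qed.

Lemma class_scal (c : C) (phi : Z -> X) :
  class_on_Z phi -> class_on_Z (fun t => scal c (phi t)).
Proof.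
  destruct hF as [(_ & _ & _ & Hs & _) _].
  intros [[M HM] H1]. split; [|exact (Hs c _ H1)].
  exists (Cmod c * M). intros t. eapply Rle_trans; [exact (norm_scal c (phi t))|].
  rewrite Rmult_assoc. apply Rmult_le_compat_l; [apply Cmod_ge_0|apply HM].
Qed.

Lemma class_translate (h : Z) (phi : Z -> X) :
  class_on_Z phi -> class_on_Z (fun t => phi (t + h)%Z).
Proof.
  destruct hF as [_ [_ Ht]]. intros [[M HM] H1]. split.
  - exists (M * w h). intros t. eapply Rle_trans; [apply HM|].
    rewrite Rmult_assoc, (Rmult_comm (w h)).
    apply Rmult_le_compat_l; [exact (bounded_by_nonneg w hw M phi HM)|].
    apply (weight_submult w hw).
  - exact (Ht phi (bounded_by_BUC w hw M phi HM) H1 h).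
Qed.

Lemma class_opB (m : nat) (b : nat -> C) (nu : nat -> Z) (phi : Z -> X) :
  class_on_Z phi -> class_on_Z (opB m b nu phi).
Proof.
  intros Hphi. induction m as [|m IH].
  - apply (class_ext (fun k => scal (b 0%nat) (phi (k + nu 0%nat)%Z))).
    + intros k. now rewrite opB_0.
    + now apply class_scal, class_translate.
  - apply (class_ext (fun k => plus (opB m b nu phi k) (scal (b (S m)) (phi (k + nu (S m))%Z)))).
    + intros k. now rewrite opB_S.
    + apply class_plus; [exact IH|]. now apply class_scal, class_translate.
Qed.

Lemma class_closed (phi : Z -> X) (M : R) :
  bounded_by w M phi ->
  (forall eps, 0 < eps -> exists chi, class_on_Z chi /\
     forall t, norm (minus (phi t) (chi t)) <= eps * w t) ->
  class_on_Z phi.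
Proof.
  destruct hF as [(_ & _ & _ & _ & Hc) _].
  intros HM H. split; [now exists M|]. apply Hc.
  - destruct (bounded_by_BUC w hw M phi HM) as [M' HM'].
    exists M'. intros t. apply HM'.
  (* Halving turns the pointwise weak bound into the strict one required of [wnorm]. *)
  - intros eps He. destruct (H (eps / 2)) as (chi & [_ Hchi] & Hd); [lra|].
    exists (restrict J chi). split; [exact Hchi|].
    apply Rle_lt_trans with (eps / 2); [|lra].
    apply wnorm_le; [lra|]. intros t. unfold restrict.
    pose proof (weight_ge1 w hw (proj1_sig t)).
    apply Rle_div_l; [lra|]. apply Hd.
Qed.

(** * Stability of the class under convolution *)

Definition truncate (N : nat) (f : Z -> C) : Z -> C :=
  fun k => if Z_le_gt_dec (Z.abs k) (Z.of_nat N) then f k else RtoC 0.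

Definition single (k0 : Z) (f : Z -> C) : Z -> C :=
  fun k => if Z.eq_dec k k0 then f k else RtoC 0.

Lemma decays_restrict (g : Z -> C) (r : nat) (K : R) (f : Z -> C) :
  decays w r K f -> (forall k, g k = f k \/ g k = RtoC 0) -> decays w r K g.
Proof.
  intros Hf Hg k. destruct (Hg k) as [-> | ->]; [apply Hf|].
  rewrite Cmod_0, Rmult_0_r. exact (decays_nonneg w hw r K f Hf).
Qed.

Lemma class_conv_single (chi : Z -> X) (f : Z -> C) (k0 : Z) :
  class_on_Z chi -> class_on_Z (conv chi (single k0 f)).
Proof.
  intros Hchi.
  apply (class_ext (fun t => scal (single k0 f k0) (chi (t + - k0)%Z))).
  - intros t. rewrite (conv_single chi (single k0 f) k0); [reflexivity|].
    intros k Hk. unfold single. now destruct (Z.eq_dec k k0).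
  - now apply class_scal, class_translate.
Qed.

(** A finitely supported kernel yields a finite combination of translates; each step adds the two
    indices N + 1 and -(N + 1). *)
Lemma class_conv_truncate (chi : Z -> X) (f : Z -> C) (K : R) (N : nat) :
  class_on_Z chi -> decays w 2 K f -> class_on_Z (conv chi (truncate N f)).
Proof.
  intros Hchi Hf. destruct (proj1 Hchi) as [M HM].
  assert (Hs : forall k0, decays w 2 K (single k0 f)).
  { intros k0. apply (decays_restrict _ _ _ f Hf). intros k. unfold single.
    destruct (Z.eq_dec k k0); tauto. }
  assert (Ht : forall N, decays w 2 K (truncate N f)).
  { intros N'. apply (decays_restrict _ _ _ f Hf). intros k. unfold truncate.
    destruct (Z_le_gt_dec (Z.abs k) (Z.of_nat N')); tauto. }
  induction N as [|N IH].
  - replace (truncate 0 f) with (single 0 f); [now apply class_conv_single|].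
    extensionality k. unfold truncate, single.
    destruct (Z.eq_dec k 0), (Z_le_gt_dec (Z.abs k) (Z.of_nat 0)); reflexivity || lia.
  - set (k1 := Z.of_nat (S N)).
    set (g := fun k => Cplus (single k1 f k) (single (- k1) f k)).
    assert (Hg : decays w 2 K g).
    { apply (decays_restrict _ _ _ f Hf). intros k. unfold g, single.
      destruct (Z.eq_dec k k1), (Z.eq_dec k (- k1)); try lia;
        rewrite ?Cplus_0_l, ?Cplus_0_r; tauto. }
    replace (truncate (S N) f) with (fun k => Cplus (truncate N f k) (g k)).
    + apply (class_ext (fun t => plus (conv chi (truncate N f) t)
        (plus (conv chi (single k1 f) t) (conv chi (single (- k1) f) t)))).
      * intros t. rewrite (conv_plus_r w hw chi (truncate N f) g M K K t HM (Ht N) Hg).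
        unfold g. now rewrite (conv_plus_r w hw chi _ _ M K K t HM (Hs k1) (Hs (- k1)%Z)).
      * apply class_plus; [exact IH|]. apply class_plus; now apply class_conv_single.
    + extensionality k. unfold g, truncate, single, k1.
      destruct (Z_le_gt_dec (Z.abs k) (Z.of_nat N)),
        (Z_le_gt_dec (Z.abs k) (Z.of_nat (S N))),
        (Z.eq_dec k (Z.of_nat (S N))), (Z.eq_dec k (- Z.of_nat (S N)));
        rewrite ?Cplus_0_l, ?Cplus_0_r; reflexivity || lia.
Qed.

(** Where the tail lives, [rho k] is at least N + 1, so one power of [rho] is traded for the factor
    1 / (N + 1). *)
Lemma decays_tail (f : Z -> C) (K : R) (N : nat) :
  decays w 3 K f -> decays w 2 (K / INR (S N)) (fun k => Cminus (f k) (truncate N f k)).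
Proof.
  intros Hf k.
  pose proof (decays_nonneg w hw 3 K f Hf) as HK.
  assert (HN : 0 < INR (S N)) by (apply lt_0_INR; lia).
  unfold truncate. destruct (Z_le_gt_dec (Z.abs k) (Z.of_nat N)) as [Hk|Hk].
  - replace (f k - f k)%C with (RtoC 0) by ring. rewrite Cmod_0, Rmult_0_r.
    apply Rmult_le_pos; [exact HK|]. now apply Rlt_le, Rinv_0_lt_compat.
  - replace (f k - RtoC 0)%C with (f k) by ring.
    apply (proj1 (Rle_div_r _ _ _ HN)).
    eapply Rle_trans; [|apply (Hf k)].
    assert (Hr : INR (S N) <= rho k).
    { unfold rho. rewrite <- abs_IZR, S_INR, INR_IZR_INZ.
      assert (IZR (Z.of_nat N) <= IZR (Z.abs k)) by (apply IZR_le; lia). lra. }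
    replace (w k * rho k ^ 3 * Cmod (f k)) with (w k * rho k ^ 2 * Cmod (f k) * rho k) by ring.
    apply Rmult_le_compat_l; [|exact Hr].
    pose proof (weight_ge1 w hw k). pose proof (rho_ge1 k).
    repeat apply Rmult_le_pos; auto using Cmod_ge_0; lra.
Qed.

Lemma minus_eq_of_plus (x y z : X) : x = plus y z -> minus x y = z.
Proof.
  intros ->. rewrite (plus_comm y z). exact (plus_plus_opp z y).
Qed.

Lemma class_conv (chi : Z -> X) (f : Z -> C) (K : R) :
  class_on_Z chi -> decays w 3 K f -> class_on_Z (conv chi f).
Proof.
  intros Hchi Hf3. pose proof (decays_pred w hw 2 K f Hf3) as Hf.
  destruct (proj1 Hchi) as [M HM].
  pose proof (bounded_by_nonneg w hw M chi HM) as HM0.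
  pose proof (decays_nonneg w hw 2 K f Hf) as HK0.
  apply (class_closed _ (4 * (M * K))).
  - intros t. apply (conv_exists w hw chi f M K t HM Hf).
  - intros eps He.
    destruct (nfloor_ex (4 * (M * K) / eps)) as [N [_ HN]].
    { pose proof (Rmult_le_pos M K HM0 HK0).
      apply Rmult_le_pos; [lra|now apply Rlt_le, Rinv_0_lt_compat]. }
    assert (HNp : 0 < INR (S N)) by (apply lt_0_INR; lia).
    assert (HNe : 4 * (M * K) <= eps * INR (S N)).
    { rewrite (Rmult_comm eps). apply (proj1 (Rle_div_l _ _ _ He)). rewrite S_INR. lra. }
    exists (conv chi (truncate N f)). split; [now apply (class_conv_truncate chi f K)|].
    intros t.
    pose proof (decays_tail f K N Hf3) as Htail.
    assert (Ht : decays w 2 K (truncate N f)).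
    { apply (decays_restrict _ _ _ f Hf). intros k. unfold truncate.
      destruct (Z_le_gt_dec (Z.abs k) (Z.of_nat N)); tauto. }
    rewrite (minus_eq_of_plus (conv chi f t) (conv chi (truncate N f) t)
      (conv chi (fun k => Cminus (f k) (truncate N f k)) t)).
    + eapply Rle_trans; [apply (conv_exists w hw chi _ M _ t HM Htail)|].
      apply Rmult_le_compat_r; [pose proof (weight_ge1 w hw t); lra|].
      replace (4 * (M * (K / INR (S N)))) with (4 * (M * K) / INR (S N)) by (field; lra).
      apply (proj2 (Rle_div_l _ _ _ HNp)). exact HNe.
    + rewrite <- (conv_plus_r w hw chi _ _ M K _ t HM Ht Htail).
      f_equal. extensionality k. ring.
Qed.

(* Modulo [F], [phi] equals [(U o opB)^n phi] for every [n], and after convolution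
   with [f] these iterates tend to zero. *)
Lemma class_conv_of_fixed_point (U : X -> X) (B : R) (m : nat) (b : nat -> C) (nu : nat -> Z)
  (phi eta : Z -> X) (f : Z -> C) (K r : R) :
  is_linear U -> 0 <= B -> (forall x, norm (U x) <= B * norm x) ->
  (forall chi, class_on_Z chi -> class_on_Z (fun t => U (chi t))) ->
  (exists M, bounded_by w M phi) -> class_on_Z eta ->
  (forall t, phi t = plus (U (opB m b nu phi t)) (eta t)) ->
  0 <= r -> B * r < 1 ->
  (forall j, decays w 3 (K * r ^ j) (Nat.iter j (opB (X := C_NormedModule) m b nu) f)) ->
  class_on_Z (conv phi f).
Proof.
  intros HU HB HUB HUF [M HM] Heta Hfix Hr HBr Hf3.
  assert (Hf : forall j, decays w 2 (K * r ^ j) (Nat.iter j (opB (X := C_NormedModule) m b nu) f))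
    by (intros j; apply decays_pred; auto).
  pose proof (bounded_by_nonneg w hw M phi HM) as HM0.
  set (it := fun n => Nat.iter n (fun chi t => U (opB m b nu chi t)) phi).
  assert (Hit : forall n, exists M', bounded_by w M' (it n))
    by (intros n; exact (iter_bounded_by w hw U m b nu phi M n HU HM)).
  (* By linearity the remainders obey chi_(n+1) = U (opB chi_n) + eta, starting from 0. *)
  assert (Hrem : forall n, exists chi, class_on_Z chi /\
    forall t, phi t = plus (it n t) (chi t)).
  { induction n as [|n (chi & Hchi & IH)].
    - exists (fun _ => zero). split; [apply class_zero|].
      intros t. now rewrite plus_zero_r.
    - exists (fun t => plus (U (opB m b nu chi t)) (eta t)). split.
      + apply class_plus; [|exact Heta]. now apply HUF, class_opB.
      + intros t. rewrite Hfix, plus_assoc. f_equal.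
        change (U (opB m b nu phi t) = plus (U (opB m b nu (it n) t)) (U (opB m b nu chi t))).
        rewrite <- (linear_plus U HU), <- opB_plus. f_equal. f_equal.
        extensionality s. apply IH. }
  pose proof (Hf 0%nat) as Hf0. simpl in Hf0. rewrite Rmult_1_r in Hf0.
  pose proof (Hf3 0%nat) as Hf30. simpl in Hf30. rewrite Rmult_1_r in Hf30.
  pose proof (decays_nonneg w hw 2 K f Hf0) as HK.
  apply (class_closed _ (4 * (M * K))).
  { intros t. apply (conv_exists w hw phi f M K t HM Hf0). }
  intros eps He.
  (* Adding 1 keeps the denominator positive when [M * K] is 0. *)
  destruct (pow_lt_1_zero (B * r)) with (y := eps / (4 * (M * K) + 1)) as [n Hn].
  { rewrite Rabs_pos_eq by (now apply Rmult_le_pos). exact HBr. }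
  { apply Rdiv_lt_0_compat; [exact He|]. pose proof (Rmult_le_pos M K HM0 HK). lra. }
  specialize (Hn n (le_n n)).
  destruct (Hrem n) as (chi & Hchi & Heq). destruct (Hit n) as [M' HM'].
  exists (conv chi f). split; [now apply (class_conv chi f K)|].
  intros t. destruct (proj1 Hchi) as [M'' HM''].
  rewrite (minus_eq_of_plus _ _ (conv (it n) f t)).
  - eapply Rle_trans.
    { apply (norm_conv_iter_le w hw U B m b nu phi M n f t HU HB HUB HM).
      intros j. eexists; apply Hf. }
    pose proof (proj2 (conv_exists w hw phi _ M _ t HM (Hf n))) as Hle.
    apply (Rmult_le_compat_l (B ^ n)) in Hle; [|now apply pow_le].
    eapply Rle_trans; [exact Hle|].
    replace (B ^ n * (4 * (M * (K * r ^ n)) * w t))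
      with ((4 * (M * K) * (B * r) ^ n) * w t) by (rewrite Rpow_mult_distr; ring).
    apply Rmult_le_compat_r; [pose proof (weight_ge1 w hw t); lra|].
    assert (Hp : 0 <= (B * r) ^ n) by (apply pow_le, Rmult_le_pos; assumption).
    rewrite Rabs_pos_eq in Hn by exact Hp.
    assert (HMK : 0 <= M * K) by now apply Rmult_le_pos.
    apply Rlt_div_r in Hn; [|lra]. nra.
  - rewrite plus_comm, <- (conv_plus_l w hw (it n) chi f M' M'' K t HM' HM'' Hf0).
    f_equal. extensionality s. apply Heq.
Qed.

End RestrictedClass.

(** Modulation by [zeta] moves the zero of the symbol to the trivial character, where it says that
    the coefficients [cc] sum to zero: this is [Hp] itself. It also cancels against the character,
    so the transform of [f] is the sum of [g]. *)
Lemma exists_test_function (w : Z -> R) (hw : is_weight w) (hg : polynomial_growth w)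
  (m : nat) (b : nat -> C) (nu : nat -> Z) (zeta : C) (B : R) :
  unit_circle zeta -> pB m b nu zeta = RtoC 0 -> 0 <= B ->
  exists (f : Z -> C) (K r : R),
    0 <= r /\ B * r < 1 /\
    (forall j, decays w 3 (K * r ^ j) (Nat.iter j (opB (X := C_NormedModule) m b nu) f)) /\
    forall gamma, (forall n, gamma n = char_Z zeta n) -> fourier f gamma <> RtoC 0.
Proof.
  intros Hz Hp HB. pose proof (unit_circle_neq_0 zeta Hz) as Hz0.
  destruct (weight_rho_pow_le w hw hg) as (N & c & Hwc).
  set (cc := fun j => Cmult (b j) (Cpowz zeta (nu j))).
  destruct (iter_opB_le (fun k => w k * rho k ^ 3) (weight_rho_submult w hw 3) m cc nu Hp)
    as (D & HD & Hiter).
  (* Then [B * (D * eps)] is below 1/2, also when [B * D] vanishes. *)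
  set (eps := / (2 * (B * D + 1))).
  assert (HBD : 0 <= B * D) by now apply Rmult_le_pos.
  assert (Heps : 0 < eps) by (apply Rinv_0_lt_compat; lra).
  (* [N] powers of [rho] absorb the weight and three give [decays w 3]. *)
  destruct (exists_band_limited (N + 3) eps Heps) as (g & K & Hg0 & Hgpos & Hg).
  assert (Hgp : forall n k, w k * rho k ^ 3 *
    Cmod (diff (G := C_AbelianGroup) n (fun k => RtoC (g k)) k) <= (Rabs c * K) * eps ^ n).
  { intros n k. rewrite diff_RtoC, Cmod_R.
    pose proof (rho_ge1 k) as Hr. specialize (Hg n k).
    assert (Hw : w k * rho k ^ 3 <= Rabs c * rho k ^ (2 * (N + 3))).
    { apply Rle_trans with (c * rho k ^ N * rho k ^ 3).
      - apply Rmult_le_compat_r; [apply pow_le; lra|apply Hwc].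
      - rewrite Rmult_assoc, <- pow_add.
        apply Rle_trans with (Rabs c * rho k ^ (N + 3)).
        + apply Rmult_le_compat_r; [apply pow_le; lra|apply Rle_abs].
        + apply Rmult_le_compat_l; [apply Rabs_pos|]. apply Rle_pow; [exact Hr|lia]. }
    apply Rle_trans with (Rabs c * rho k ^ (2 * (N + 3)) * Rabs (diff n g k)).
    - apply Rmult_le_compat_r; [apply Rabs_pos|exact Hw].
    - rewrite !Rmult_assoc. apply Rmult_le_compat_l; [apply Rabs_pos|exact Hg]. }
  set (f := fun k => Cmult (Cpowz zeta k) (RtoC (g k))).
  assert (Hf : forall j, decays w 3 (Rabs c * K * (D * eps) ^ j)
    (Nat.iter j (opB (X := C_NormedModule) m b nu) f)).
  { intros j k.
    assert (E : Nat.iter j (opB (X := C_NormedModule) m b nu) f = fun k => Cmult (Cpowz zeta k)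
      (Nat.iter j (opB (X := C_NormedModule) m cc nu) (fun k => RtoC (g k)) k)).
    { induction j as [|j IH]; [reflexivity|]. simpl.
      eapply eq_trans; [exact (f_equal (opB (X := C_NormedModule) m b nu) IH)|].
      extensionality i. now apply opB_modulate. }
    eapply Rle_trans; [right|exact (Hiter _ _ _ Hgp j k)]. apply (f_equal (Rmult _)).
    eapply eq_trans; [exact (f_equal Cmod (equal_f E k))|].
    now rewrite Cmod_mult, Cmod_Cpowz, Rmult_1_l. }
  exists f, (Rabs c * K), (D * eps). repeat split.
  - apply Rmult_le_pos; lra.
  - unfold eps. replace (B * (D * / (2 * (B * D + 1)))) with ((B * D) / (2 * (B * D + 1)))
      by (field; lra).
    apply Rlt_div_l; lra.
  - exact Hf.
  - intros gamma Hgamma.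
    assert (Hdom : forall k, norm (g k : R_CompleteNormedModule) <= Rabs c * K / rho k ^ 2).
    { intros k. change (Rabs (g k) <= Rabs c * K / rho k ^ 2).
      pose proof (rho_ge1 k). pose proof (weight_ge1 w hw k).
      apply (proj1 (Rle_div_r _ _ _ (pow_lt (rho k) 2 ltac:(lra)))).
      specialize (Hgp 0%nat k). rewrite pow_O, Rmult_1_r in Hgp.
      change (w k * rho k ^ 3 * Cmod (g k) <= Rabs c * K) in Hgp. rewrite Cmod_R in Hgp.
      eapply Rle_trans; [|exact Hgp].
      rewrite Rmult_comm. apply Rmult_le_compat_r; [apply Rabs_pos|].
      assert (1 <= rho k ^ 2) by (apply pow_R1_Rle; lra).
      change (rho k ^ 3) with (rho k * rho k ^ 2). rewrite <- Rmult_assoc.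
      assert (1 <= w k * rho k) by nra. nra. }
    destruct (is_sumZ_dominated (V := R_CompleteNormedModule) g _ Hdom) as (s & Hs & _).
    pose proof (is_sumZ_pos g s Hg0 Hgpos Hs) as Hspos.
    assert (E : fourier f gamma = RtoC s).
    { apply (sumZ_unique (V := C_CompleteNormedModule)).
      apply (is_sumZ_ext (fun k => RtoC (g k))).
      - intros k. rewrite Hgamma. unfold char_Z, f.
        rewrite Cmult_assoc, <- Cpowz_plus by exact Hz0.
        replace (- k + k)%Z with 0%Z by lia. simpl. now rewrite Cmult_1_l.
      - apply (is_sumZ_additive (V := R_NormedModule) (V' := C_NormedModule) RtoC 1 g s).
        + intros x y. apply RtoC_plus.
        + intros x. change (Cmod (RtoC x) <= 1 * Rabs x). rewrite Cmod_R. lra.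
        + exact Hs. }
    rewrite E. intros H0. apply RtoC_inj in H0. lra.
Qed.

Theorem theorem12p3
  (X : CompleteNormedModule C_AbsRing)
  (J : index_set)
  (w : Z -> R) (hw : is_weight w)
  (F : (elt J -> X) -> Prop) (hF : admissible_class w J F)
  (D : X -> Prop) (A : X -> X)
  (hA : closed_densely_defined D A)
  (hres : exists lambda : C, resolvent_set D A lambda)
  (m : nat) (b : nat -> C) (nu : nat -> Z)
  (phi psi : Z -> X)
  (hgrowth : polynomial_growth w)
  (hphi : BUC w phi) (hpsi : BUC w psi)
  (hY : exists Y : (X -> X) -> Prop,
      closed_subspace_L Y /\
      (forall (lambda : C) (S : X -> X), is_resolvent_op D A lambda S -> Y S) /\
      (forall (xi : elt J -> X) (S : X -> X), F xi -> Y S -> F (fun t => S (xi t))))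
  (heq : forall n : Z, D (phi n) /\ opB m b nu phi n = plus (A (phi n)) (psi n))
  (hpsiF : F (restrict J psi)) :
  forall z : C,
    (exists gamma : Z -> C, sp w J F phi gamma /\ z = thetaB m b nu gamma) ->
    spectrum D A z /\ (exists zeta : C, unit_circle zeta /\ z = pB m b nu zeta).
Proof.
  intros z (gamma & [[zeta [Hzeta Hgamma]] Hsp] & Hz).
  assert (Hpz : z = pB m b nu zeta).
  { rewrite Hz. unfold thetaB. rewrite Hgamma. apply thetaB_char. }
  split; [|now exists zeta].
  intros [S HS].
  assert (HSF : forall xi : elt J -> X, F xi -> F (fun t => S (xi t))).
  { destruct hY as (Y & _ & HY1 & HY2). intros xi Hxi. exact (HY2 xi S Hxi (HY1 z S HS)). }
  destruct HS as (HSlin & _ & HSinv).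
  (* [opB m' b' nu'] is [B - z] *)
  set (m' := Datatypes.S m).
  (* The shift by z becomes one more term, of index m + 1, coefficient -z and displacement 0, so the
     results on [opB] apply unchanged. *)
  set (b' := fun j => if Nat.leb j m then b j else Copp z).
  set (nu' := fun j => if Nat.leb j m then nu j else 0%Z).
  assert (Hlast : b' m' = Copp z /\ nu' m' = 0%Z).
  { unfold b', nu', m'. now rewrite (proj2 (Nat.leb_gt _ _) (Nat.lt_succ_diag_r m)). }
  assert (HopB : forall n, opB m' b' nu' phi n = plus (opB m b nu phi n) (opp (scal z (phi n)))).
  { intros n. unfold m'. rewrite opB_S. fold m'. rewrite (proj1 Hlast), (proj2 Hlast).
    f_equal.
    - unfold opB. apply sum_n_ext_loc. intros j Hj. unfold b', nu'.
      now rewrite (proj2 (Nat.leb_le _ _) Hj).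
    - rewrite Z.add_0_r. exact (scal_opp_l z (phi n)). }
  assert (Hp' : pB m' b' nu' zeta = RtoC 0).
  { unfold pB, m'. rewrite sum_Sn. fold m'. rewrite (proj1 Hlast), (proj2 Hlast).
    rewrite (sum_n_ext_loc _ (fun j => Cmult (b j) (Cpowz zeta (nu j)))).
    - fold (pB m b nu zeta). rewrite <- Hpz. simpl Cpowz.
      change (z + - z * RtoC 1 = RtoC 0)%C. ring.
    - intros j Hj. unfold b', nu'. now rewrite (proj2 (Nat.leb_le _ _) Hj). }
  set (U := fun x => opp (S x)).
  assert (HU : is_linear U) by exact (is_linear_comp S opp HSlin is_linear_opp).
  destruct (linear_norm U HU) as (B & HB & HUB).
  destruct (exists_test_function w hw hgrowth m' b' nu' zeta B Hzeta Hp' (Rlt_le _ _ HB))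
    as (f & K & r & Hr & HBr & Hdec & Hfour).
  (* The goal is [False]: the spectrum would force the transform of [f] to vanish at [gamma] once
     [f] is in [L1] and its convolution with [phi] is in [F]. *)
  apply (Hfour gamma Hgamma), Hsp.
  - apply (L1_decays w hw K).
    apply (decays_pred w hw). rewrite <- (Rmult_1_r K). exact (Hdec 0%nat).
  - assert (HF_S : forall chi, class_on_Z w J F chi -> class_on_Z w J F (fun t => S (chi t))).
    { intros chi [[M HM] Hchi]. split; [|exact (HSF _ Hchi)].
      exact (linear_bounded_by w S chi M HSlin HM). }
    refine (proj2 (class_conv_of_fixed_point w hw J F hF U B m' b' nu' phi (fun t => S (psi t))
      f K r HU (Rlt_le _ _ HB) HUB _ _ _ _ Hr HBr Hdec)).
    + intros chi Hchi.
      apply (class_ext w J F (fun t => scal (opp one) (S (chi t)))).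
      * intros t. exact (scal_opp_one (S (chi t))).
      * apply class_scal; auto.
    + now apply BUC_bounded_by.
    + apply HF_S. split; [now apply BUC_bounded_by|exact hpsiF].
    + intros t. destruct (heq t) as [HD Heq]. specialize (HSinv (phi t) HD).
      rewrite HopB, Heq. unfold U.
      set (y := plus (plus (A (phi t)) (psi t)) (opp (scal z (phi t)))).
      (* With y = (B - z) phi the equation reads psi = y + (z - A) phi. In this grouping [S] meets
         (z - A) phi as one vector, and the left-inverse property on [D] returns [phi]. *)
      assert (E : psi t = plus y (minus (scal z (phi t)) (A (phi t)))).
      { unfold y, minus. rewrite plus_assoc.
        transitivity (plus (plus (A (phi t)) (psi t)) (opp (A (phi t)))).
        - rewrite (plus_comm (A (phi t))). exact (eq_sym (plus_plus_opp (psi t) (A (phi t)))).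
        - exact (f_equal (fun x => plus x (opp (A (phi t))))
            (eq_sym (plus_minus_l (plus (A (phi t)) (psi t)) (scal z (phi t))))). }
      change (phi t = plus (opp (S y)) (S (psi t))). clearbody y.
      rewrite E, (linear_plus S HSlin), plus_assoc.
      transitivity (plus zero (phi t)); [symmetry; apply plus_zero_l|].
      f_equal; symmetry; [exact (plus_opp_l (S y))|exact HSinv].
Qed.
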